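(* Let $P \subset \mathbb{R}^n$ be a smooth $n$-dimensional $\mathbb{Q}$-normal lattice polytope. Then $\operatorname{codeg}(P) \geq \frac{n+1}{2}$ if and only if $P$ is affinely isomorphic to one of the following polytopes: (i) $s\Delta_1$ for some integer $s\geq 1$ (here $n=1$); (ii) $3\Delta_3$ (here $n=3$); (iii) $2\Delta_n$; (iv) $\operatorname{Cayley}^1(P_0, \ldots, P_k)$ for some $k \geq \frac{n-1}{2}$ and some lattice polytopes $P_0,\dots,P_k$ (all of the same dimension and with the same normal fan); (v) $\operatorname{Cayley}^2(a_0\Delta_1, a_1\Delta_1, \ldots, a_{n-1}\Delta_1)$, where $n$ is odd and $a_0,\dots,a_{n-1}$ are positive integers all congruent modulo $2$.
   Context: A lattice polytope is the convex hull of finitely many points of $\mathbb{Z}^n$; affine isomorphisms are lattice-preserving affine isomorphisms. $\Delta_n$ denotes the standard $n$-dimensional unimodular simplex, and $s\Delta_n$ its $s$-th dilate. An $n$-dimensional lattice polytope $P\subset\mathbb{R}^n$ is smooth if exactly $n$ facets meet at each vertex and the primitive inner normal vectors of these facets form a basis of $\mathbb{Z}^n$. The codegree $\operatorname{codeg}(P)$ is the smallest positive integer $c$ such that $cP$ contains a lattice point in its interior. Adjoint polytopes: if $P$ has facet presentation $P=\{x : \langle \eta_i,x\rangle\ge -a_i,\ 1\le i\le r\}$ with $\eta_i$ the primitive inner facet normals, then for $t\ge 0$ set $P^{(t)}=\{x : \langle \eta_i,x\rangle\ge -a_i+t,\ 1\le i\le r\}$. Let $\sigma(P)=\sup\{t\ge0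 : P^{(t)}\neq\varnothing\}$ and $\lambda(P)=\sup\{t\ge 0: P^{(t)}\ne\varnothing \text{ and the normal fan of } P^{(t)} \text{ equals that of } P\}$. $P$ is called $\mathbb{Q}$-normal if $\sigma(P)=\lambda(P)$. Generalized Cayley polytopes: for $m$-dimensional lattice polytopes $P_0,\dots,P_k\subset\mathbb{R}^m$ and a positive integer $s$, $[P_0*\cdots*P_k]^s=\operatorname{Conv}(P_0\times\{0\},P_1\times\{se_1\},\dots,P_k\times\{se_k\})\subset\mathbb{R}^m\times\mathbb{R}^k$, where $e_1,\dots,e_k$ is a basis of $\mathbb{Z}^k$. When all $P_i$ have the same normal fan, this polytope is denoted $\operatorname{Cayley}^s(P_0,\dots,P_k)$ (a strict $s$-th order generalized Cayley polytope). *)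

(* Defs.v *)
From HB Require Import structures.
From mathcomp Require Import all_boot all_order all_algebra.
From mathcomp Require Import boolp classical_sets reals constructive_ereal ereal.
Set Implicit Arguments. Unset Strict Implicit. Unset Printing Implicit Defensive.
Import Order.TTheory GRing.Theory Num.Theory.
Local Open Scope classical_set_scope.
Local Open Scope ring_scope.

Section Polytopes.
Variable R : realType.

Definition dotv n (u x : 'rV[R]_n) : R := \sum_(j < n) u ord0 j * x ord0 j.
Definition intv n (v : 'rV[int]_n) : 'rV[R]_n := map_mx (fun z : int => z%:~R) v.

Definition lattice_pt n (x : 'rV[R]_n) : Prop := forall j, x ord0 j \is a Num.int.

Definition conv n (S : set 'rV[R]_n) : set 'rV[R]_n :=
  [set x | exists (k : nat) (w : 'I_k -> R) (p : 'I_k -> 'rV[R]_n),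
     (forall i, S (p i)) /\ (forall i, 0 <= w i) /\ \sum_i w i = 1 /\
     x = \sum_i w i *: p i].

Definition lattice_polytope n (P : set 'rV[R]_n) : Prop :=
  exists V : seq 'rV[R]_n, (forall v, v \in V -> lattice_pt v) /\
    P = conv [set v | v \in V].

Definition affdim_ge n (S : set 'rV[R]_n) (d : nat) : Prop :=
  exists p : 'I_d.+1 -> 'rV[R]_n, (forall i, S (p i)) /\
    row_free (\matrix_(j < d) (p (lift ord0 j) - p ord0)).

Definition full_dim n (P : set 'rV[R]_n) : Prop := affdim_ge P n.

Definition vertex n (P : set 'rV[R]_n) (v : 'rV[R]_n) : Prop :=
  P v /\ forall x y, P x -> P y -> v = 2^-1 *: (x + y) -> x = y.

Definition primitive n (eta : 'rV[int]_n) : Prop :=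
  forall (d : int) (w : 'rV[int]_n), eta = d *: w -> d = 1 \/ d = -1.

Definition facet_pres n (P : set 'rV[R]_n) (r : nat)
    (eta : 'I_r -> 'rV[int]_n) (a : 'I_r -> R) : Prop :=
  [/\ forall i, primitive (eta i),
      injective eta,
      P = [set x | forall i, - a i <= dotv (intv (eta i)) x] &
      forall i, affdim_ge [set x | P x /\ dotv (intv (eta i)) x = - a i] n.-1].

Definition smooth n (P : set 'rV[R]_n) : Prop :=
  exists r eta a, @facet_pres n P r eta a /\
    forall v, vertex P v ->
      exists f : 'I_n -> 'I_r,
        [/\ injective f,
            (forall i, dotv (intv (eta i)) v = - a i <-> exists j, f j = i) &
            (\matrix_(j < n) eta (f j)) \in unitmx].

Definition adjoint n r (eta : 'I_r -> 'rV[int]_n) (a : 'I_r -> R) (t : R)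
  : set 'rV[R]_n := [set x | forall i, - a i + t <= dotv (intv (eta i)) x].

Definition face_min n (Q : set 'rV[R]_n) (u : 'rV[R]_n) : set 'rV[R]_n :=
  [set x | Q x /\ forall y, Q y -> dotv u x <= dotv u y].
Definition normal_cone n (Q F : set 'rV[R]_n) : set 'rV[R]_n :=
  [set u | forall x y, F x -> Q y -> dotv u x <= dotv u y].
Definition normal_fan n (Q : set 'rV[R]_n) : set (set 'rV[R]_n) :=
  [set C | exists u, C = normal_cone Q (face_min Q u)].

Definition sigmaP n r eta a : \bar R :=
  ereal_sup [set t%:E | t in [set t : R | 0 <= t /\ @adjoint n r eta a t !=set0]].
Definition lambdaP n (P : set 'rV[R]_n) r eta a : \bar R :=
  ereal_sup [set t%:E | t in [set t : R | 0 <= t /\ @adjoint n r eta a t !=set0 /\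
                       normal_fan (adjoint eta a t) = normal_fan P]].

Definition Qnormal n (P : set 'rV[R]_n) : Prop :=
  exists r eta a, @facet_pres n P r eta a /\ sigmaP eta a = lambdaP P eta a.

Definition scale n (s : nat) (S : set 'rV[R]_n) : set 'rV[R]_n :=
  [set s%:R *: x | x in S].

Definition has_interior_lattice_pt n (S : set 'rV[R]_n) : Prop :=
  exists z : 'rV[R]_n, lattice_pt z /\ exists e : R, 0 < e /\
    forall y : 'rV[R]_n, (forall j, `|y ord0 j - z ord0 j| < e) -> S y.

Definition codeg_pred n (P : set 'rV[R]_n) : pred nat :=
  fun c => `[< (0 < c)%N /\ has_interior_lattice_pt (scale c P) >].

(* smallest positive c with an interior lattice point in cP (0 if none) *)
Definition codeg n (P : set 'rV[R]_n) : nat :=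
  match pselect (exists c, codeg_pred P c) with
  | left h => ex_minn h
  | right _ => 0%N
  end.

Definition lattice_iso n (P Q : set 'rV[R]_n) : Prop :=
  exists (A : 'M[int]_n) (b : 'rV[int]_n), A \in unitmx /\
    Q = [set x *m map_mx (fun z : int => z%:~R) A + intv b | x in P].

Definition cast_set m n (e : m = n) (S : set 'rV[R]_m) : set 'rV[R]_n :=
  [set castmx (erefl 1%N, e) x | x in S].

Definition simplex n : set 'rV[R]_n :=
  conv [set v | v = 0 \/ exists i : 'I_n, v = delta_mx ord0 i].

Definition cayley_e k (s : nat) (i : 'I_k.+1) : 'rV[R]_k :=
  \row_(j < k) (if (j.+1 == i)%N then s%:R else 0).
Definition cayley m k (s : nat) (Ps : 'I_k.+1 -> set 'rV[R]_m)
  : set 'rV[R]_(m + k) :=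
  conv [set z | exists i x, Ps i x /\ z = row_mx x (cayley_e s i)].

End Polytopes.

(* Main.v *)
Require Import Defs.
From HB Require Import structures.
From mathcomp Require Import all_boot all_order all_algebra.
From mathcomp Require Import boolp classical_sets reals constructive_ereal ereal.
From mathcomp Require Import perm ring lra zify.
Set Implicit Arguments. Unset Strict Implicit. Unset Printing Implicit Defensive.
Import Order.TTheory GRing.Theory Num.Theory.
Local Open Scope classical_set_scope.
Local Open Scope ring_scope.

(* Write [slack i x] for the lattice distance of [x] from the [i]-th facet. Q-normality says that
   for [t] up to the threshold [la = sigma(P)] every vertex [v] of [P] survives in the adjoint
   polytope as the point at distance [t] from the facets through [v]. Hence (a) [c P] has an
   interior lattice point as soon as [c * la >= 1], so the codegree hypothesis bounds [la] above;
   and (b) some facets stay at distance exactly [la] from all of the last adjoint polytope.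
   Following Batyrev, a nonnegative integral relation of least weight between the normals of such
   facets has the form [x_0 + ... + x_p = 0], with every proper subfamily spanning a cone of the
   fan. The slacks of these [p + 1] facets add up on [P] to an integer [s = (p + 1) la], so [P] maps
   to the [s]-th dilate of the unimodular [p]-simplex, and the bound on [la] becomes
   [floor(n / 2) * s < p + 1 <= n + 1].
   If [s = 1] every vertex of [P] lies over a vertex of the simplex: this is case (iv). If [p = n]
   then [P] is the whole dilated simplex. Otherwise [n] is odd, [p = n - 1] and [s = 2], and since
   the slacks at vertices are multiples of [la = 2 / n], no vertex lies over the midpoint of an
   edge: this is case (v). *)

(** The codegree is at least (n + 1) / 2 exactly when it exceeds floor(n / 2), so c = floor(n / 2)
    cannot satisfy c * la >= 1; multiplying floor(n / 2) * la < 1 by p + 1 gives the inequality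
    stated above. No completeness theorem for fans is invoked: a cone containing an integral vector
    w is found by minimising w over P, and smoothness makes the coordinates of w there natural
    numbers. Weights of two expressions of the same vector are compared by evaluating both along the
    segment from a vertex v to the point at distance la from the facets through v. The converse has
    its own argument when n > 1: if k + 1 integral affine forms are nonnegative on P and have
    constant sum s, each of them, homogenised, is at least 1 at an interior lattice point of cP, so
    k + 1 <= c * s. *)

(** * Dot products and integral vectors *)

Section Dot.
Context {R : realType} {n : nat}.
Implicit Types u v x y : 'rV[R]_n.

Lemma dotvE u x : dotv u x = (u *m x^T) ord0 ord0.
Proof. by rewrite mxE; apply: eq_bigr => j _; rewrite mxE. Qed.

Lemma dotvC u x : dotv u x = dotv x u.
Proof. by apply: eq_bigr => j _; rewrite mulrC. Qed.

Lemma dotvDr u x y : dotv u (x + y) = dotv u x + dotv u y.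
Proof. by rewrite !dotvE linearD mulmxDr mxE. Qed.

Lemma dotvZr u c x : dotv u (c *: x) = c * dotv u x.
Proof. by rewrite !dotvE linearZ -scalemxAr mxE. Qed.

Lemma dotvNr u x : dotv u (- x) = - dotv u x.
Proof. by rewrite -scaleN1r dotvZr mulN1r. Qed.

Lemma dotvBr u x y : dotv u (x - y) = dotv u x - dotv u y.
Proof. by rewrite dotvDr dotvNr. Qed.

Lemma dotv0r u : dotv u 0 = 0.
Proof. by rewrite -(scale0r 0) dotvZr mul0r. Qed.

Lemma dotvZl c u x : dotv (c *: u) x = c * dotv u x.
Proof. by rewrite dotvC dotvZr (dotvC x). Qed.

Lemma dotvNl u x : dotv (- u) x = - dotv u x.
Proof. by rewrite dotvC dotvNr (dotvC x). Qed.

Lemma dotv0l x : dotv 0 x = 0.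
Proof. by rewrite dotvC dotv0r. Qed.

Lemma dotv_sumr (I : Type) (s : seq I) (Q : pred I) u (F : I -> 'rV[R]_n) :
  dotv u (\sum_(i <- s | Q i) F i) = \sum_(i <- s | Q i) dotv u (F i).
Proof. exact: (big_morph _ (dotvDr u) (dotv0r u)). Qed.

Lemma dotv_suml (I : Type) (s : seq I) (Q : pred I) x (F : I -> 'rV[R]_n) :
  dotv (\sum_(i <- s | Q i) F i) x = \sum_(i <- s | Q i) dotv (F i) x.
Proof. by rewrite dotvC dotv_sumr; apply: eq_bigr => i _; rewrite dotvC. Qed.

Lemma dotv_comb k (w : 'I_k -> R) (p : 'I_k -> 'rV[R]_n) u :
  dotv u (\sum_i w i *: p i) = \sum_i w i * dotv u (p i).
Proof. by rewrite dotv_sumr; apply: eq_bigr => i _; rewrite dotvZr. Qed.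

Lemma dotv_delta (j : 'I_n) x : dotv (delta_mx ord0 j) x = x ord0 j.
Proof.
rewrite /dotv (bigD1 j) //= big1 ?addr0; first by rewrite mxE !eqxx mul1r.
by move=> i ij; rewrite mxE (negPf ij) andbF mul0r.
Qed.

Lemma dotv_deltar (j : 'I_n) x : dotv x (delta_mx ord0 j) = x ord0 j.
Proof. by rewrite dotvC dotv_delta. Qed.

Lemma dotv_eq0 u : dotv u u = 0 -> u = 0.
Proof.
move=> h; apply/rowP => j; rewrite mxE; apply/eqP.
move/eqP: h; rewrite psumr_eq0 => [|i _]; last exact: sqr_ge0.
by move=> /allP/(_ j (mem_index_enum _)); rewrite mulf_eq0 orbb.
Qed.

Lemma dotvv_ge0 u : 0 <= dotv u u.
Proof. by apply: sumr_ge0 => i _; apply: sqr_ge0. Qed.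

Lemma intvD (v w : 'rV[int]_n) : intv R (v + w) = intv R v + intv R w.
Proof. by rewrite /intv map_mxD. Qed.

Lemma intvN (v : 'rV[int]_n) : intv R (- v) = - intv R v.
Proof. by rewrite /intv map_mxN. Qed.

Lemma intvZ (c : int) (v : 'rV[int]_n) : intv R (c *: v) = c%:~R *: intv R v.
Proof. by rewrite /intv map_mxZ. Qed.

Lemma intvMn (v : 'rV[int]_n) k : intv R (v *+ k) = k%:R *: intv R v.
Proof. by rewrite -scaler_nat intvZ rmorph_nat. Qed.

Lemma intv0 : intv R (0 : 'rV[int]_n) = 0.
Proof. by rewrite /intv map_mx0. Qed.

Lemma intv_sum (I : Type) (s : seq I) (Q : pred I) (F : I -> 'rV[int]_n) :
  intv R (\sum_(i <- s | Q i) F i) = \sum_(i <- s | Q i) intv R (F i).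
Proof. exact: (big_morph _ intvD intv0). Qed.

Lemma intv_inj : injective (@intv R n).
Proof. by move=> v w /rowP h; apply/rowP => j; have := h j; rewrite !mxE => /intr_inj. Qed.

Lemma intv_delta (j : 'I_n) : intv R (delta_mx ord0 j) = delta_mx ord0 j.
Proof. by rewrite /intv map_delta_mx. Qed.

End Dot.

(* With the convention [x / 0 = 0], this single [e] serves the indices where [s] vanishes as well. *)
Lemma small_step {R : realType} (I : finType) (s g : I -> R) :
  (forall i, 0 <= s i) -> (forall i, s i = 0 -> 0 <= g i) ->
  exists2 e : R, 0 < e & forall i, 0 <= s i + e * g i.
Proof.
move=> s0 sg; set e := (1 + \sum_i `|g i| / s i)^-1.
have t0 i : 0 <= `|g i| / s i by rewrite divr_ge0.
have d0 : 0 < 1 + \sum_i `|g i| / s i by rewrite ltr_wpDr // sumr_ge0.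
have e0 : 0 < e by rewrite invr_gt0.
exists e => // i; have [si|si] := eqVneq (s i) 0.
  by rewrite si add0r mulr_ge0 ?sg // ltW.
have sp : 0 < s i by rewrite lt_neqAle eq_sym si s0.
suff : e * `|g i| <= s i.
  move=> h; have : - (e * `|g i|) <= e * g i.
    by rewrite -mulrN ler_pM2l // lerNl -normrN ler_norm.
  lra.
rewrite mulrC ler_pdivrMr // -ler_pdivrMl // mulrC.
rewrite (bigD1 i) //= addrCA lerDl addr_ge0 // sumr_ge0 // => j _; exact: t0.
Qed.

(** * Convex hulls and vertices *)

Section Conv.
Context {R : realType} {n : nat}.
Implicit Types (u v x y : 'rV[R]_n) (S : set 'rV[R]_n).

Lemma conv_sub S : S `<=` conv S.
Proof.
move=> x Sx; exists 1%N, (fun=> 1), (fun=> x).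
by rewrite !big_ord1 scale1r; do !split.
Qed.

Lemma conv_mono S S' : S `<=` S' -> conv S `<=` conv S'.
Proof. by move=> h x [k [w [p [hp H]]]]; exists k, w, p; split=> // i; apply/h/hp. Qed.

Lemma conv_ge S u c : (forall x, S x -> c <= dotv u x) -> forall x, conv S x -> c <= dotv u x.
Proof.
move=> h x [k [w [p [Sp [w0 [w1 ->]]]]]]; rewrite dotv_comb -[c]mul1r -w1 mulr_suml.
by apply: ler_sum => i _; rewrite ler_wpM2l ?h.
Qed.

Lemma conv_le S u c : (forall x, S x -> dotv u x <= c) -> forall x, conv S x -> dotv u x <= c.
Proof.
move=> h x Sx; rewrite -lerN2 -dotvNl; apply: conv_ge Sx => y /h.
by rewrite dotvNl lerN2.
Qed.

Lemma sum_pos_ex (k : nat) (w : 'I_k -> R) : (forall i, 0 <= w i) -> \sum_i w i = 1 ->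
  exists i, 0 < w i.
Proof.
move=> w0 w1; apply: contrapT => /forallNP h.
have : \sum_i w i = 0.
  by apply: big1 => i _; apply/eqP; rewrite eq_le w0 andbT leNgt; apply/negP/h.
by rewrite w1 => /eqP; rewrite oner_eq0.
Qed.

(** A functional that is minimal over [S] at x is constant on the points of positive weight in a
    convex representation of x. Points of weight zero are replaced by a point of positive weight, so
    that all points used lie on the smallest face through x. *)
Lemma conv_face S x : conv S x ->
  conv [set p | S p /\ forall u, (forall y, S y -> dotv u x <= dotv u y) -> dotv u p = dotv u x] x.
Proof.
move=> [k [w [p [Sp [w0 [w1 xE]]]]]]; have [i0 wi0] := sum_pos_ex w0 w1.
have key i : 0 < w i -> forall u, (forall y, S y -> dotv u x <= dotv u y) -> dotv u (p i) = dotv u x.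
  move=> wi u hu; have : \sum_i w i * (dotv u (p i) - dotv u x) = 0.
    rewrite {1}xE dotv_comb; under eq_bigr do rewrite mulrBr.
    by rewrite sumrB -mulr_suml w1 mul1r -dotv_comb -xE subrr.
  have H : (forall i, true -> 0 <= w i * (dotv u (p i) - dotv u x)).
    by move=> j _; rewrite mulr_ge0 // subr_ge0 hu.
  move=> /eqP; rewrite psumr_eq0 // => /allP/(_ i (mem_index_enum _)) /=.
  by rewrite mulf_eq0 gt_eqF //= subr_eq0 => /eqP.
exists k, w, (fun i => if w i == 0 then p i0 else p i); split; [|split=> //; split=> //].
  move=> i; case: eqP => wi; split; rewrite ?(Sp _) //; apply: key => //.
  by rewrite lt_neqAle w0 eq_sym andbT; apply/eqP.
by rewrite xE; apply: eq_bigr => i _; case: eqP => // ->; rewrite !scale0r.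
Qed.

Lemma conv_some_le S x u : conv S x -> exists2 p, S p & dotv u p <= dotv u x.
Proof.
move=> Sx; apply: contrapT => h.
move: (Sx) => [k [w [p [Sp [w0 [w1 xE]]]]]]; have [i0 wi0] := sum_pos_ex w0 w1.
have hp i : dotv u x < dotv u (p i).
  by rewrite ltNge; apply/negP => h2; apply: h; exists (p i).
have /eqP : \sum_i w i * (dotv u (p i) - dotv u x) = 0.
  rewrite {1}xE; under eq_bigr do rewrite mulrBr.
  by rewrite sumrB -mulr_suml w1 mul1r -dotv_comb -xE subrr.
rewrite psumr_eq0; last by move=> i _; rewrite mulr_ge0 // subr_ge0 ltW.
move=> /allP/(_ i0 (mem_index_enum _)) /=.
by rewrite mulf_eq0 gt_eqF //= subr_eq0 gt_eqF.
Qed.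

Lemma conv_convex S x y t : 0 <= t <= 1 -> conv S x -> conv S y ->
  conv S (t *: x + (1 - t) *: y).
Proof.
move=> /andP[t0 t1] [k [w [p [Sp [w0 [w1 ->]]]]]] [k' [w' [p' [Sp' [w'0 [w'1 ->]]]]]].
exists (k + k')%N, (fun i => match split i with inl j => t * w j | inr j => (1 - t) * w' j end),
  (fun i => match split i with inl j => p j | inr j => p' j end).
split; first by move=> i; case: split.
split; first by move=> i; case: split => j; rewrite mulr_ge0 // subr_ge0.
have L (j : 'I_k) : split (lshift k' j) = inl j by exact: (unsplitK (inl j)).
have L' (j : 'I_k') : split (rshift k j) = inr j by exact: (unsplitK (inr j)).
split.
  rewrite big_split_ord /=; under eq_bigr do rewrite L.
  under [X in _ + X]eq_bigr do rewrite L'.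
  by rewrite -!mulr_sumr w1 w'1; ring.
rewrite big_split_ord /= !scaler_sumr; congr (_ + _); apply: eq_bigr => j _.
  by rewrite L scalerA.
by rewrite L' scalerA.
Qed.

Lemma vertex_in_conv S v : vertex (conv S) v -> S v.
Proof.
move=> [[k [w [p [Sp [w0 [w1 vE]]]]]] hv].
have [i0 wi0] := sum_pos_ex w0 w1.
have wi1 : w i0 <= 1 by rewrite -w1 (bigD1 i0) //= lerDl sumr_ge0.
suff -> : v = p i0 by exact: Sp.
pose e := w i0 / 2.
pose a := v + e *: (p i0 - v).
pose b := v - e *: (p i0 - v).
have Sv : conv S v by exists k, w, p.
have Ca : conv S a.
  have -> : a = e *: p i0 + (1 - e) *: v.
    by rewrite /a scalerBr scalerBl scale1r addrCA.
  by apply: conv_convex => //; [rewrite /e; lra | exact: conv_sub].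
have Cb : conv S b.
  (* The weight at [i0] stays nonnegative because e is half of [w i0]; so v can also be moved away
     from [p i0], and being a vertex it must equal [p i0]. *)
  exists k, (fun i => (1 + e) * w i - (if i == i0 then e else 0)), p.
  split=> //; split.
    move=> i; case: eqP => [->|_]; last by rewrite subr0 mulr_ge0 // /e; lra.
    have : 0 <= e * w i0 by rewrite mulr_ge0 // /e; lra.
    rewrite mulrDl mul1r /e; lra.
  split.
    by rewrite sumrB -mulr_sumr w1 -big_mkcond big_pred1_eq; ring.
  under eq_bigr do rewrite scalerBl -scalerA.
  rewrite sumrB -scaler_sumr -vE (bigD1 i0) //= eqxx big1 => [|i /negPf->]; last by rewrite scale0r.
  by rewrite addr0 /b scalerBr scalerDl scale1r opprB addrA.
have := hv a b Ca Cb; rewrite /a /b.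
have -> : v + e *: (p i0 - v) + (v - e *: (p i0 - v)) = 2 *: v.
  by rewrite addrACA subrr addr0 scaler_nat mulr2n.
rewrite scalerA mulVf ?pnatr_eq0 // scale1r => /(_ erefl) /addrI /eqP.
rewrite -subr_eq0 opprK -mulr2n -scaler_nat scalerA scaler_eq0 mulf_eq0 pnatr_eq0 /=.
by rewrite /e mulf_eq0 invr_eq0 pnatr_eq0 orbF gt_eqF //= subr_eq0 => /eqP ->.
Qed.

Lemma conv_split S p x : conv S x -> x = p \/
  exists t y, [/\ 0 <= t < 1, conv (S `\ p) y & x = t *: p + (1 - t) *: y].
Proof.
move=> [k [w [q [Sq [w0 [w1 xE]]]]]].
pose t := \sum_(i | q i == p) w i.
have tE : \sum_(i | q i != p) w i = 1 - t by move: w1; rewrite (bigID (fun i => q i == p)) /= -/t => <-; rewrite addrAC subrr add0r.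
have t0 : 0 <= t by apply: sumr_ge0.
have t1 : 0 <= 1 - t by rewrite -tE; apply: sumr_ge0.
have xE2 : x = t *: p + \sum_(i | q i != p) w i *: q i.
  rewrite xE (bigID (fun i => q i == p)) /= scaler_suml; congr (_ + _).
  by apply: eq_bigr => i /eqP ->.
have [tt|tt] := eqVneq (1 - t) 0.
  left; rewrite xE2 big1 => [|i hi].
    by rewrite addr0 -[t](subKr 1) tt subr0 scale1r.
  have /eqP : \sum_(i | q i != p) w i = 0 by rewrite tE.
  rewrite psumr_eq0 // => /allP/(_ i (mem_index_enum _)); rewrite hi /= => /eqP ->.
  by rewrite scale0r.
right; have [i0 hi0] : exists i0, q i0 != p.
  apply: contrapT => /forallNP h; move/eqP: tt; apply; rewrite -tE big1 // => i hi.
  by case: (h i).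
exists t, (\sum_(i | q i != p) (w i / (1 - t)) *: q i); split.
- by rewrite t0 /= -subr_gt0 lt_neqAle eq_sym tt.
- exists k, (fun i => if q i != p then w i / (1 - t) else 0), (fun i => if q i != p then q i else q i0).
  split.
    by move=> i; case: ifP => hi; split=> //=; apply/eqP => //; rewrite hi.
  split; first by move=> i; case: ifP => // _; rewrite divr_ge0.
  split; first by rewrite -big_mkcond /= -mulr_suml tE divff.
  rewrite big_mkcond; apply: eq_bigr => i _; case: ifP => //.
  by rewrite scale0r.
rewrite xE2 scaler_sumr; congr (_ + _); apply: eq_bigr => i _.
by rewrite scalerA mulrC divfK.
Qed.

(** A non-vertex p is the midpoint of distinct a and b. Splitting off the weights s, t < 1 of p in a
    and b and solving for p expresses it through the remaining points, with weights proportional to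
    1 - s and 1 - t. *)
Lemma conv_remove S p : conv S p -> ~ vertex (conv S) p -> conv S `<=` conv (S `\ p).
Proof.
move=> Sp np; suff Cp : conv (S `\ p) p.
  move=> x /(conv_split p)[->//|[t [y [/andP[t0 t1] Cy ->]]]].
  by apply: conv_convex => //; rewrite t0 ltW.
have /existsNP[a /existsNP[b /not_implyP[Ca /not_implyP[Cb /not_implyP[pE ab]]]]] :
    ~ forall x y, conv S x -> conv S y -> p = 2^-1 *: (x + y) -> x = y.
  by move=> h; apply: np.
have pE2 : p + p = a + b.
  by rewrite {1 2}pE -scalerDl -[2^-1]mul1r -splitr scale1r.
have [ap|[s [a' [/andP[s0 s1] Ca' aE]]]] := conv_split p Ca.
  by case: ab; move: pE2; rewrite ap => /addrI.
have [bp|[t [b' [/andP[t0 t1] Cb' bE]]]] := conv_split p Cb.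
  by case: ab; move: pE2; rewrite bp => /addIr ->.
pose d := 2 - s - t.
have d0 : 0 < d by rewrite /d; lra.
have -> : conv (S `\ p) p = conv (S `\ p) (((1 - s) / d) *: a' + (1 - (1 - s) / d) *: b').
  congr (conv _ _).
  have -> : 1 - (1 - s) / d = (1 - t) / d by apply: (mulIf (lt0r_neq0 d0)); rewrite mulrBl !divfK ?gt_eqF // /d; ring.
  apply: (scalerI (lt0r_neq0 d0)); rewrite scalerDr !scalerA !(mulrC d) !divfK ?gt_eqF //.
  apply/rowP => j; move: pE2; rewrite aE bE => /rowP/(_ j); rewrite /d !mxE; lra.
apply: conv_convex => //; apply/andP; split.
  by rewrite divr_ge0 ?(ltW d0) // subr_ge0 ltW.
rewrite ler_pdivrMr // /d; lra.
Qed.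

(** Minkowski's theorem for finitely generated hulls: non-vertices are discarded one at a time, by
    induction on the size of a generating list. *)
Lemma conv_vertices (V : seq 'rV[R]_n) :
  conv [set v | v \in V] = conv [set v | v \in V /\ vertex (conv [set v | v \in V]) v].
Proof.
set P := conv [set v | v \in V]; apply/seteqP; split; last by apply: conv_mono => x [].
suff H m : forall W : seq 'rV[R]_n, (size W <= m)%N -> {subset W <= V} ->
    P `<=` conv [set v | v \in W] -> P `<=` conv [set v | v \in V /\ vertex P v].
  by apply: (H _ V (leqnn _)).
elim: m => [|m IH] W sW WV PW; have [hW|/existsNP[p /not_implyP[pW np]]] :=
    pselect (forall p, p \in W -> vertex P p).
- by move=> x /PW; apply: conv_mono => p pW; split; [apply: WV | apply: hW].
- by move: sW pW; rewrite leqn0 => /nilP ->.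
- by move=> x /PW; apply: conv_mono => p pW; split; [apply: WV | apply: hW].
have PE : P = conv [set v | v \in W].
  by apply/seteqP; split=> //; apply: conv_mono => x; apply: WV.
have sub : P `<=` conv ([set v | v \in W] `\ p).
  rewrite PE; apply: conv_remove; first exact: conv_sub.
  by rewrite -PE.
apply: (IH [seq y <- W | y != p]).
- rewrite -ltnS; apply: leq_trans sW; rewrite size_filter -(count_predC (predC1 p) W).
  by rewrite -[X in (X < _)%N]addn0 ltn_add2l -has_count; apply/hasP; exists p => //=; rewrite eqxx.
- by move=> y; rewrite mem_filter => /andP[_ /WV].
by move=> x /sub; apply: conv_mono => y [/= yW yp]; rewrite mem_filter /= yW andbT; apply/eqP.
Qed.

(** The vertices spanning the smallest face through x have x in their hull, so one of them does not
    increase w. *)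
Lemma vertex_below (V : seq 'rV[R]_n) (P : set 'rV[R]_n) x w :
  P = conv [set v | v \in V] -> P x ->
  exists v, [/\ vertex P v, dotv w v <= dotv w x &
    forall u, (forall y, P y -> dotv u x <= dotv u y) -> dotv u v = dotv u x].
Proof.
move=> PE Px; have := Px; rewrite {1}PE conv_vertices -PE => /conv_face.
move=> /(conv_some_le w)[v [[_ vv] hu] wv]; exists v; split=> // u h.
by apply: hu => y [yV _]; apply: h; rewrite PE; apply: conv_sub.
Qed.

Lemma seq_min (T : eqType) (f : T -> R) (s : seq T) (t0 : T) : t0 \in s ->
  exists2 z, z \in s & forall t, t \in s -> f z <= f t.
Proof.
elim: s t0 => // a s IH t0 _; case: s IH => [|b s] IH.
  by exists a; rewrite ?mem_head // => z; rewrite inE => /eqP ->.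
have [z zs hz] := IH b (mem_head _ _); case: (leP (f a) (f z)) => h.
  exists a; rewrite ?mem_head // => t; rewrite inE => /orP[/eqP->//|/hz]; exact: le_trans.
exists z; first by rewrite inE zs orbT.
by move=> t; rewrite inE => /orP[/eqP->|/hz//]; exact: ltW.
Qed.

Lemma vertex_min (V : seq 'rV[R]_n) (P : set 'rV[R]_n) w :
  P = conv [set v | v \in V] -> P !=set0 ->
  exists2 v, vertex P v & forall x, P x -> dotv w v <= dotv w x.
Proof.
move=> PE [x0 Px0]; have [v0 v0V] : exists v, v \in V.
  by move: Px0; rewrite PE => /(conv_some_le 0)[v vV _]; exists v.
have [p pV hp] := seq_min (dotv w) v0V.
have Pp : P p by rewrite PE; apply: conv_sub.
have [v [vv vp _]] := vertex_below w PE Pp; exists v => // x Px; apply: le_trans vp _.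
by move: Px; rewrite PE; apply: conv_ge.
Qed.

End Conv.

(** * Smooth polytopes *)

Section Basis.
Context {R : realType} {n : nat} (y : 'I_n -> 'rV[int]_n).
Hypothesis yB : (\matrix_(j < n) y j) \in unitmx.
Let B := \matrix_(j < n) y j.
Let BR : 'M[R]_n := map_mx intr B.
Let IR : 'M[R]_n := map_mx intr (invmx B).

Let BI : BR *m IR = 1%:M. Proof. by rewrite -map_mxM mulmxV // map_mx1. Qed.
Let IB : IR *m BR = 1%:M. Proof. by rewrite -map_mxM mulVmx // map_mx1. Qed.

Let BE (x : 'rV[R]_n) j : (BR *m x^T) j ord0 = dotv (intv R (y j)) x.
Proof. by rewrite mxE; apply: eq_bigr => k _; rewrite !mxE. Qed.

Lemma basis_solve (c : 'I_n -> R) : exists q, forall j, dotv (intv R (y j)) q = c j.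
Proof.
exists (IR *m \col_j c j)^T => j.
by rewrite -BE trmxK mulmxA BI mul1mx mxE.
Qed.

Lemma basis_uniq q q' :
  (forall j, dotv (intv R (y j)) q = dotv (intv R (y j)) q') -> q = q'.
Proof.
move=> h; apply: trmx_inj; rewrite -[q^T]mul1mx -[q'^T]mul1mx -IB -!mulmxA.
by congr (_ *m _); apply/colP => j; rewrite !BE.
Qed.

Lemma basis_lattice q :
  (forall j, dotv (intv R (y j)) q \is a Num.int) -> lattice_pt q.
Proof.
move=> h j; have -> : q ord0 j = (IR *m (BR *m q^T)) j ord0.
  by rewrite mulmxA IB mul1mx mxE.
by rewrite mxE rpred_sum // => k _; rewrite BE mxE rpredM ?intr_int.
Qed.

Lemma basis_coord_int (w : 'rV[int]_n) : exists b, w = \sum_j b j *: y j.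
Proof.
exists (fun j => (w *m invmx B) ord0 j).
have {1}-> : w = w *m invmx B *m B by rewrite mulmxKV.
by rewrite mulmx_sum_row; apply: eq_bigr => j _; rewrite rowK.
Qed.

Lemma basis_coord (u : 'rV[R]_n) : exists b, u = \sum_j b j *: intv R (y j).
Proof.
exists (fun j => (u *m IR) ord0 j).
have {1}-> : u = u *m IR *m BR by rewrite -mulmxA IB mulmx1.
rewrite mulmx_sum_row; apply: eq_bigr => j _; congr (_ *: _).
by apply/rowP => k; rewrite !mxE.
Qed.

Lemma basis_dual j : exists d, forall k, dotv (intv R (y k)) d = (k == j)%:R.
Proof. exact: basis_solve. Qed.

End Basis.

Section SmoothPres.
Context {R : realType} {n r : nat}.
Implicit Types (P : set 'rV[R]_n) (eta : 'I_r -> 'rV[int]_n) (a : 'I_r -> R).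

Definition slack eta a i (x : 'rV[R]_n) : R := dotv (intv R (eta i)) x + a i.

Definition vertex_basis eta a (v : 'rV[R]_n) (f : 'I_n -> 'I_r) : Prop :=
  [/\ injective f, forall i, slack eta a i v = 0 <-> exists j, f j = i &
      (\matrix_(j < n) eta (f j)) \in unitmx].

(** Combines the half-space description, the lattice generators and the unimodular vertex cones in a
    form that is preserved by unimodular affine maps. *)
Record smooth_pres P eta a (V : seq 'rV[R]_n) : Prop := SmoothPres {
  sp_half : P = [set x | forall i, 0 <= slack eta a i x];
  sp_lat : forall v, v \in V -> lattice_pt v;
  sp_conv : P = conv [set v | v \in V];
  sp_basis : forall v, vertex P v -> exists f, vertex_basis eta a v f;
  sp_nonempty : P !=set0 }.

Lemma slackD eta a i x d (e : R) :
  slack eta a i (x + e *: d) = slack eta a i x + e * dotv (intv R (eta i)) d.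
Proof. by rewrite /slack dotvDr dotvZr addrAC. Qed.

Lemma slack_comb eta a i k (w : 'I_k -> R) p : \sum_j w j = 1 ->
  slack eta a i (\sum_j w j *: p j) = \sum_j w j * slack eta a i (p j).
Proof.
move=> w1; rewrite /slack dotv_comb; under [RHS]eq_bigr do rewrite mulrDr.
by rewrite big_split /= -mulr_suml w1 mul1r.
Qed.

Section Theory.
Context P eta a V (sp : smooth_pres P eta a V).
Local Notation sl := (slack eta a).

Lemma sp_in x : P x <-> forall i, 0 <= sl i x.
Proof. by rewrite (sp_half sp). Qed.

Lemma sp_ge0 x i : P x -> 0 <= sl i x.
Proof. by move=> /sp_in. Qed.

Lemma sp_convex S : S `<=` P -> conv S `<=` P.
Proof.
move=> SP x [k [w [p [Sp [w0 [w1 ->]]]]]]; apply/sp_in => i.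
by rewrite slack_comb // sumr_ge0 // => j _; rewrite mulr_ge0 // sp_ge0 //; apply: SP.
Qed.

Lemma sp_vertex_min w : exists2 v, vertex P v & forall x, P x -> dotv w v <= dotv w x.
Proof. exact: vertex_min (sp_conv sp) (sp_nonempty sp). Qed.

Lemma sp_vertex_below x w : P x -> exists v, [/\ vertex P v, dotv w v <= dotv w x &
  forall i, sl i x = 0 -> sl i v = 0].
Proof.
move=> Px; have [v [vv wv hv]] := vertex_below w (sp_conv sp) Px; exists v; split=> // i six.
rewrite -six /slack (hv (intv R (eta i))) // => y Py.
by have := sp_ge0 i Py; rewrite -six /slack lerD2r.
Qed.

Lemma sp_vertex_lat v : vertex P v -> lattice_pt v.
Proof. by rewrite {1}(sp_conv sp) => /vertex_in_conv; apply: (sp_lat sp). Qed.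

Lemma vertex_mem v : vertex P v -> P v. Proof. by case. Qed.

Lemma vertex_dir v f d : P v -> vertex_basis eta a v f ->
  (forall j, 0 <= dotv (intv R (eta (f j))) d) -> exists2 e, 0 < e & P (v + e *: d).
Proof.
move=> Pv [_ hf _] hd.
have [|e e0 he] := @small_step R _ (fun i => sl i v) (fun i => dotv (intv R (eta i)) d) (fun i => sp_ge0 i Pv).
  by move=> i /hf[j <-].
by exists e => //; apply/sp_in => i; rewrite slackD.
Qed.

(** The direction dual to the j-th normal at v is an edge direction of P, and along it u changes at
    rate [b j]. Hence the normal cone at v is spanned by the normals of the facets through v. *)
Lemma min_coord v f u b : P v -> vertex_basis eta a v f ->
  u = \sum_j b j *: intv R (eta (f j)) -> (forall x, P x -> dotv u v <= dotv u x) ->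
  forall j, 0 <= b j.
Proof.
move=> Pv vf uE hu j; have [_ _ fB] := vf.
have [d hd] := basis_dual (R := R) fB j.
have [k|e e0 Pe] := vertex_dir (d := d) Pv vf; first by rewrite hd; case: eqP.
have := hu _ Pe; rewrite dotvDr lerDl dotvZr pmulr_rge0 // uE dotv_suml (bigD1 j) //= big1.
  by rewrite dotvZl hd eqxx mulr1 addr0.
by move=> k kj; rewrite dotvZl hd (negPf kj) mulr0.
Qed.

Lemma vertex_basis_inj v v' f : vertex_basis eta a v f ->
  (forall j, sl (f j) v' = 0) -> v' = v.
Proof.
move=> [_ hf fB] h; apply: (basis_uniq fB) => j.
have : sl (f j) v = 0 by apply/hf; exists j.
by have := h j; rewrite /slack => h1 h2; apply: (addIr (a (f j))); rewrite h1 h2.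
Qed.

Lemma tight_int v i : vertex P v -> sl i v = 0 -> a i \is a Num.int.
Proof.
move=> /sp_vertex_lat vl /eqP; rewrite /slack addrC addr_eq0 => /eqP ->.
by rewrite rpredN rpred_sum // => j _; rewrite rpredM // mxE intr_int.
Qed.

Lemma slack_int v i : a i \is a Num.int -> lattice_pt v -> sl i v \is a Num.int.
Proof.
move=> ai vl; rewrite rpredD // rpred_sum // => j _.
by rewrite rpredM // mxE intr_int.
Qed.

End Theory.

(** Exactly n facets are tight at v, so any n distinct tight ones are a permutation of those listed
    by f. *)
Lemma smooth_basis eta a v f (g : 'I_n -> 'I_r) : vertex_basis eta a v f ->
  injective g -> (forall j, slack eta a (g j) v = 0) -> vertex_basis eta a v g.
Proof.
move=> [fi hf fB] gi hg.
have hs j : exists k, f k == g j by have [k <-] := (hf (g j)).1 (hg j); exists k.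
pose s j := xchoose (hs j).
have fs j : f (s j) = g j by apply/eqP/(xchooseP (hs j)).
have si : injective s by move=> j k jk; apply: gi; rewrite -!fs jk.
split=> //.
  move=> i; split=> [/hf[j <-]|[j <-]//].
  have [s' s's ss'] := injF_bij si.
  by exists (s' j); rewrite -fs ss'.
have -> : \matrix_j eta (g j) = row_perm (perm si) (\matrix_j eta (f j)).
  by apply/matrixP => j k; rewrite !mxE permE fs.
by rewrite row_permE unitmx_mul unitmx_perm.
Qed.

Lemma smooth_presI P eta a (V : seq 'rV[R]_n) : (forall v, v \in V -> lattice_pt v) ->
  P = conv [set v | v \in V] -> P !=set0 -> facet_pres P eta a ->
  (forall v, vertex P v -> exists f : 'I_n -> 'I_r, [/\ injective f,
     (forall i, dotv (intv R (eta i)) v = - a i <-> exists j, f j = i) &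
     (\matrix_(j < n) eta (f j)) \in unitmx]) -> smooth_pres P eta a V.
Proof.
move=> Vl PV P0 [_ _ PE _] hv; split=> //.
  rewrite PE; apply: eq_set => x; apply: eq_forall => i.
  by rewrite /slack -lerBlDr sub0r.
move=> v /hv[f [fi hf fB]]; exists f; split=> // i; rewrite -hf /slack.
by split=> [/eqP|->]; rewrite ?addNr // addr_eq0 => /eqP.
Qed.

End SmoothPres.

(** * Facets and adjoint polytopes *)

Section FacetUniqueness.
Context {R : realType} {n : nat}.
Implicit Types (P : set 'rV[R]_n).

Lemma kernel_line (M : 'M[R]_(n.-1, n)) (u u' : 'rV[R]_n) : (0 < n)%N -> row_free M ->
  u != 0 -> M *m u^T = 0 -> M *m u'^T = 0 -> exists c, u' = c *: u.
Proof.
move=> n0 fM u0 Mu Mu'; have K (w : 'rV[R]_n) : M *m w^T = 0 -> (w <= kermx M^T)%MS.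
  by move=> Mw; apply/sub_kermxP; apply: trmx_inj; rewrite trmx_mul trmxK Mw trmx0.
have rK : \rank (kermx M^T) = 1%N.
  by rewrite mxrank_ker mxrank_tr (eqP fM) -[X in (X - _)%N](prednK n0) subSnn.
have Ku : (kermx M^T <= u)%MS.
  by rewrite -(mxrank_leqif_sup (K _ Mu)) rK rank_rV u0.
by have /sub_rVP := submx_trans (K _ Mu') Ku.
Qed.

Lemma primitive_neq0 (eta : 'rV[int]_n) : primitive eta -> eta != 0.
Proof. by move=> h; apply/eqP => e0; have [] := h 0 0; rewrite ?scaler0. Qed.

(** By Bezout on a coordinate where [eta] does not vanish, both vectors are integral multiples of
    one integral vector [W]; primitivity makes both multipliers 1 or -1. *)
Lemma primitive_parallel (eta eta' : 'rV[int]_n) (c : R) : primitive eta -> primitive eta' ->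
  intv R eta' = c *: intv R eta -> eta' = eta \/ eta' = - eta.
Proof.
move=> pe pe' cE; have [k k0] : exists k, eta ord0 k != 0.
  apply: contrapT => /forallNP h; have /eqP := primitive_neq0 pe; apply.
  by apply/rowP => k; rewrite mxE; apply/eqP; apply: contrapT => /negP; exact: h.
set al := eta ord0 k in k0 *; pose be := eta' ord0 k.
have prop l : be * eta ord0 l = al * eta' ord0 l.
  apply: (@intr_inj R); rewrite !intrM.
  have /rowP E := cE; have := E l; have := E k; rewrite !mxE -/al -/be => -> ->; ring.
pose g := gcdz al be.
have g0 : g != 0 by rewrite gcdz_eq0 negb_and k0.
have /dvdzP[al' alE] : (g %| al)%Z by exact: dvdz_gcdl.
have /dvdzP[be' beE] : (g %| be)%Z by exact: dvdz_gcdr.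
have [s [t st]] := Bezoutz al be; rewrite -/g in st.
pose W := s *: eta + t *: eta'.
have eW : eta = al' *: W.
  apply/rowP => l; rewrite !mxE; apply: (mulfI g0).
  rewrite -{1}st mulrDl -!mulrA (prop l) mulrCA alE; ring.
have e'W : eta' = be' *: W.
  apply/rowP => l; rewrite !mxE; apply: (mulfI g0).
  rewrite -{1}st mulrDl -!mulrA -(prop l) beE; ring.
have [a1|a1] := pe _ _ eW; have [b1|b1] := pe' _ _ e'W; move: eW e'W; rewrite a1 b1;
  move: (W) => w -> ->; rewrite ?scaleN1r ?scale1r ?opprK; by [left | right].
Qed.

Lemma full_dim_const P (u : 'rV[R]_n) c : full_dim P -> (forall x, P x -> dotv u x = c) -> u = 0.
Proof.
move=> [p [Pp rf]] h; move: rf; rewrite row_free_unit; set M := (X in X \in unitmx) => Mu.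
have Mu0 : M *m u^T = 0.
  apply/colP => j; rewrite mxE [RHS]mxE.
  transitivity (dotv (p (lift ord0 j) - p ord0) u).
    by apply: eq_bigr => k _; rewrite !mxE.
  by rewrite dotvC dotvBr !h // subrr.
by apply: trmx_inj; rewrite -[u^T](mulKmx Mu) Mu0 mulmx0 trmx0.
Qed.

(** Let z be the barycentre of n affinely independent points of facet i. If no inequality of the
    second presentation were tight at z, one could leave P through facet i while satisfying all of
    them. A tight one is tight at all n points, so its normal is parallel to [eta i]; the opposite
    sign would confine P to a hyperplane. *)
Lemma facet_pres_sub P r (eta : 'I_r -> 'rV[int]_n) a r' (eta' : 'I_r' -> 'rV[int]_n) a' :
  (0 < n)%N -> full_dim P -> facet_pres P eta a -> facet_pres P eta' a' ->
  forall i, exists i', eta i = eta' i' /\ a i = a' i'.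
Proof.
move=> n0 fd [pr _ PE fac] [pr' _ PE' _] i.
have [p [hp rf]] := fac i.
pose N : R := n.-1.+1%:R; have N0 : N != 0 by rewrite pnatr_eq0.
pose z := \sum_(j < n.-1.+1) N^-1 *: p j.
have sumN : \sum_(j < n.-1.+1) N^-1 = 1 by rewrite sumr_const card_ord -mulr_natl divff.
have P0 x : P x -> forall i, 0 <= slack eta a i x.
  by rewrite PE => h j; have := h j; rewrite /slack -lerBlDr sub0r.
have P0' x : P x <-> forall i, 0 <= slack eta' a' i x.
  by rewrite PE'; split=> h j; have := h j; rewrite /slack -lerBlDr sub0r.
have sz j : slack eta' a' j z = N^-1 * \sum_k slack eta' a' j (p k).
  by rewrite slack_comb // mulr_sumr.
have szi : slack eta a i z = 0.
  by rewrite slack_comb // big1 // => k _; rewrite /slack (hp k).2 addNr mulr0.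
have eta0 := primitive_neq0 (pr i).
have [i' zi'] : exists i', slack eta' a' i' z = 0.
  apply: contrapT => /forallNP h.
  have s0 j : 0 <= slack eta' a' j z.
    by rewrite sz mulr_ge0 ?invr_ge0 ?ler0n // sumr_ge0 // => k _; apply: (P0' _).1 (hp k).1 j.
  have [|e e0 he] := @small_step R _ (fun j => slack eta' a' j z)
     (fun j => dotv (intv R (eta' j)) (- intv R (eta i))) s0; first by move=> j /h.
  have : P (z + e *: - intv R (eta i)) by apply/P0' => j; rewrite slackD.
  move=> /P0/(_ i); rewrite slackD szi add0r dotvNr mulrN oppr_ge0 pmulr_rle0 // => le0.
  have /dotv_eq0/eqP : dotv (intv R (eta i)) (intv R (eta i)) = 0.
    by apply/eqP; rewrite eq_le le0 dotvv_ge0.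
  by rewrite -(@intv0 R) (inj_eq intv_inj) (negPf eta0).
have pi' k : slack eta' a' i' (p k) = 0.
  move: zi'; rewrite sz => /eqP; rewrite mulf_eq0 invr_eq0 (negPf N0) /= psumr_eq0.
    by move=> /allP/(_ k (mem_index_enum _)) /= /eqP.
  by move=> j _; apply: (P0' _).1 (hp j).1 i'.
exists i'; set M := (X in row_free X) in rf.
have MT u : (forall k, dotv u (p k) = dotv u (p ord0)) -> M *m u^T = 0.
  move=> hu; apply/colP => j; rewrite mxE [RHS]mxE.
  transitivity (dotv (p (lift ord0 j) - p ord0) u).
    by apply: eq_bigr => k _; rewrite !mxE.
  by rewrite dotvC dotvBr hu subrr.
have pE k : dotv (intv R (eta i)) (p k) = - a i by exact: (hp k).2.
have pE' k : dotv (intv R (eta' i')) (p k) = - a' i'.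
  by have /eqP := pi' k; rewrite addr_eq0 => /eqP.
have [c cE] : exists c, intv R (eta' i') = c *: intv R (eta i).
  apply: (kernel_line n0 rf).
  - by rewrite -(@intv0 R) (inj_eq intv_inj).
  - by apply: MT => k; rewrite !pE.
  - by apply: MT => k; rewrite !pE'.
have [ee|ee] := primitive_parallel (pr i) (pr' i') cE.
  by split=> //; apply: oppr_inj; rewrite -(pE ord0) -(pE' ord0) ee.
have aN : a' i' = - a i.
  by apply: oppr_inj; rewrite -(pE' ord0) ee intvN dotvNl pE.
have : intv R (eta i) = 0.
  apply: (full_dim_const (c := - a i) fd) => x Px.
  have := P0 _ Px i; have := (P0' _).1 Px i'.
  rewrite /slack ee aN intvN dotvNl => h1 h2; lra.
by move=> /eqP; rewrite -(@intv0 R) (inj_eq intv_inj) (negPf eta0).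
Qed.

End FacetUniqueness.

Section Adjoint.
Context {R : realType} {n r : nat} (P : set 'rV[R]_n).
Context (eta : 'I_r -> 'rV[int]_n) (a : 'I_r -> R) (V : seq 'rV[R]_n).
Hypothesis sp : smooth_pres P eta a V.
Hypothesis n0 : (0 < n)%N.
Local Notation sl := (slack eta a).

Lemma adjointE t x : adjoint eta a t x <-> forall i, t <= sl i x.
Proof. by split=> h i; have := h i; rewrite /slack; lra. Qed.

Lemma adjoint_sub t x : 0 <= t -> adjoint eta a t x -> P x.
Proof. by move=> t0 /adjointE h; apply/(sp_in sp) => i; apply: le_trans t0 (h i). Qed.

(** Equality of the fans makes the normal cone [C] of v the normal cone of a face of the adjoint
    polytope, and this face is one point x because [C] contains a basis. Every normal tight at x
    lies in [C], so it has nonnegative integral coordinates in that basis. *)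
Lemma adjoint_vertex t v f : injective eta -> (forall i, primitive (eta i)) ->
  adjoint eta a t !=set0 ->
  normal_fan (adjoint eta a t) = normal_fan P -> vertex P v -> vertex_basis eta a v f ->
  exists x, adjoint eta a t x /\ forall j, sl (f j) x = t.
Proof.
move=> ei pr Qn fanE vv vf; have [_ hf fB] := vf; have Pv := vertex_mem vv.
set Q := adjoint eta a t in Qn fanE *.
pose y j := intv R (eta (f j)).
have ymin j x : P x -> dotv (y j) v <= dotv (y j) x.
  move=> /(sp_ge0 sp (f j)); have : sl (f j) v = 0 by apply/hf; exists j.
  by rewrite /slack => <-; rewrite lerD2r.
pose u := \sum_j y j; pose C := normal_cone P (face_min P u).
have umin x : face_min P u x -> x = v.
  move=> [Px xu]; apply: (vertex_basis_inj vf) => j.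
  have sv : forall j, sl (f j) v = 0 by move=> k; apply/hf; exists k.
  have D k : 0 <= dotv (y k) x - dotv (y k) v by rewrite subr_ge0 ymin.
  have : \sum_k (dotv (y k) x - dotv (y k) v) = 0.
    apply/eqP; rewrite eq_le sumr_ge0 // andbT sumrB -!dotv_suml subr_le0; exact: xu.
  move=> /eqP; rewrite psumr_eq0 // => /allP/(_ j (mem_index_enum _)) /=.
  by rewrite subr_eq0 => /eqP; rewrite -(sv j) /slack => <-.
have vmin : face_min P u v.
  by split=> // x Px; rewrite !dotv_suml; apply: ler_sum => j _; apply: ymin.
have CP w : C w <-> forall x, P x -> dotv w v <= dotv w x.
  by split=> [h x Px|h x z /umin -> Pz]; [apply: h | apply: h].
have Cy j : C (y j) by apply/CP => x; apply: ymin.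
have [u' CE] : normal_fan Q C by rewrite fanE; exists u.
(* The normal cone of an empty face is the whole space, whereas [- y j0] is not in [C]: it decreases
   along the direction dual to [y j0], which enters P. *)
have [x Fx] : face_min Q u' !=set0.
  apply: contrapT => /nonemptyPn F0.
  have CT w : C w by rewrite CE F0.
  pose j0 := Ordinal n0; have [d hd] := basis_dual (R := R) fB j0.
  have [|e e0 Pe] := vertex_dir (d := d) sp Pv vf.
    by move=> k; rewrite hd; case: eqP.
  have /CP/(_ _ Pe) := CT (- y j0).
  rewrite !dotvNl lerN2 dotvDr gerDl dotvZr hd eqxx mulr1 leNgt e0 //.
have [Qx _] := Fx; exists x; split=> // j; apply/eqP; rewrite eq_le; apply/andP; split; last first.
  by move/adjointE: Qx; apply.
rewrite leNgt; apply/negP => tj.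
have CQ w z : C w -> Q z -> dotv w x <= dotv w z by rewrite CE => h Qz; apply: h.
have Funiq x' : face_min Q u' x' -> x' = x.
  move=> Fx'; apply: (basis_uniq fB) => k; apply/eqP; rewrite eq_le.
  have Ck := Cy k; rewrite CE in Ck; rewrite (Ck _ _ Fx' Qx) (Ck _ _ Fx) //; exact: Fx'.1.
have tightC i : sl i x = t -> C (intv R (eta i)).
  move=> ti; rewrite CE => x' z /Funiq -> /adjointE/(_ i).
  by rewrite -ti /slack lerD2r.
(* Otherwise a move [d] away from the facet [f j], backwards in [y j] but far enough forwards in the
   other [y k], would stay in [Q] and contradict the minimality of [y j] at [x]. *)
have [dj hdj] := basis_dual (R := R) fB j.
pose M := \sum_i `|dotv (intv R (eta i)) dj|.
have M0 : 0 <= M by apply: sumr_ge0.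
have [d hd] := basis_solve (R := R) fB (fun k => if k == j then -1 else M).
have Qs i : 0 <= sl i x - t by rewrite subr_ge0; move/adjointE: Qx; apply.
have [i /eqP|e e0 he] := @small_step R _ _ (fun i => dotv (intv R (eta i)) d) Qs; last first.
  have Qe : Q (x + e *: d).
    by apply/adjointE => i; rewrite -subr_ge0 slackD addrAC.
  have := CQ _ _ (Cy j) Qe; rewrite dotvDr lerDl dotvZr hd eqxx mulrN1 oppr_ge0.
  by rewrite leNgt e0.
rewrite subr_eq0 => /eqP ti.
have [c cE] := basis_coord_int fB (eta i).
have cER : intv R (eta i) = \sum_k (c k)%:~R *: y k.
  by rewrite cE intv_sum; apply: eq_bigr => k _; rewrite intvZ.
have c0 k : 0 <= c k.
  by rewrite -(ler0z R); apply: (min_coord sp Pv vf cER); apply/CP; apply: tightC.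
have cj : (c j)%:~R <= M.
  have -> : (c j)%:~R = dotv (intv R (eta i)) dj.
    rewrite cER dotv_suml (bigD1 j) //= big1 => [|k kj].
      by rewrite dotvZl hdj eqxx mulr1 addr0.
    by rewrite dotvZl hdj (negPf kj) mulr0.
  apply: le_trans (ler_norm _) _.
  by rewrite /M (bigD1 i) //= lerDl sumr_ge0.
have -> : dotv (intv R (eta i)) d = - (c j)%:~R + M * \sum_(k | k != j) (c k)%:~R.
  rewrite cER dotv_suml (bigD1 j) //= dotvZl hd eqxx mulrN1 mulr_sumr; congr (_ + _).
  by apply: eq_bigr => k kj; rewrite dotvZl hd (negPf kj) mulrC.
(* Another nonzero coordinate is at least 1, and [M] times it outweighs [c j]. Without one,
   primitivity gives i = [f j], although i has slack t and [f j] a larger slack. *)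
have [[k [kj ck]]|/forallNP hk] := pselect (exists k, k != j /\ c k != 0).
  have : 1 <= \sum_(k | k != j) (c k)%:~R :> R.
    rewrite (bigD1 k) //=; apply: ler_wpDr; last by rewrite ler1z; have := c0 k; lia.
    by rewrite sumr_ge0 // => l _; rewrite ler0z.
  by move=> /(ler_wpM2l M0); rewrite mulr1; lra.
have eE : eta i = c j *: eta (f j).
  rewrite cE (bigD1 j) //= big1 ?addr0 // => k kj.
  by have := hk k; rewrite kj; case: eqP => [->|_ []//]; rewrite scale0r.
have [c1|c1] := pr _ _ _ eE; last by have := c0 j; rewrite c1.
by move: tj; rewrite -ti (ei i (f j)) ?ltxx // eE c1 scale1r.
Qed.

(** The number [la] is sigma(P), finite because the slack of one facet is bounded on P. The supremum
    lambda(P) is only approached by values t with equal fans, so an inequality failing at [la] is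
    refuted at a nearby t. *)
Lemma adjoint_threshold : injective eta -> (forall i, primitive (eta i)) ->
  sigmaP eta a = lambdaP P eta a ->
  exists la : R, [/\ 0 <= la, (forall t, la < t -> ~ (adjoint eta a t !=set0)) &
    forall v f q, vertex P v -> vertex_basis eta a v f -> (forall j, sl (f j) q = la) ->
      adjoint eta a la q].
Proof.
move=> ei pr sE; have [v0 vv0 _] := sp_vertex_min sp 0.
have [f0 vf0] := sp_basis sp vv0; pose i0 := f0 (Ordinal n0).
have [v1 vv1 hv1] := sp_vertex_min sp (- intv R (eta i0)).
have bd t : 0 <= t -> adjoint eta a t !=set0 -> t <= sl i0 v1.
  move=> t0 [x Qx]; have /hv1 := adjoint_sub t0 Qx; rewrite !dotvNl lerN2 => h.
  by have /adjointE/(_ i0) := Qx => /le_trans; apply; rewrite lerD2r.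
have s0 : (0%:E <= sigmaP eta a)%E.
  apply: ereal_sup_ubound; exists 0 => //; split=> //; have [x Px] := sp_nonempty sp.
  by exists x; apply/adjointE => i; apply: (sp_ge0 sp).
have s1 : (sigmaP eta a <= (sl i0 v1)%:E)%E.
  by apply: ge_ereal_sup => _ [t [t0 Qn] <-]; rewrite lee_fin bd.
have [la laE] : exists la, sigmaP eta a = la%:E.
  by case: (sigmaP eta a) s0 s1 => // l _ _; exists l.
have la0 : 0 <= la by rewrite -lee_fin -laE.
exists la; split=> //.
  move=> t lat Qn; have : (t%:E <= sigmaP eta a)%E.
    apply: ereal_sup_ubound; exists t => //; split=> //; exact: ltW (le_lt_trans la0 lat).
  by rewrite laE lee_fin leNgt lat.
move=> v f q vv vf hq; apply/adjointE => i; have [_ hf fB] := vf.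
have [d hd] := basis_solve (R := R) fB (fun=> 1).
have uq x t : (forall j, sl (f j) x = t) -> x = v + t *: d.
  move=> hx; apply: (basis_uniq fB) => j; apply: (addIr (a (f j))).
  rewrite -[LHS]/(sl (f j) x) -[RHS]/(sl (f j) (v + t *: d)) hx slackD hd mulr1.
  by rewrite ((hf (f j)).2 _) ?add0r //; exists j.
rewrite (uq q la hq) slackD; set k := dotv _ d.
have sv : 0 <= sl i v by apply: (sp_ge0 sp); apply: vertex_mem.
have key t : adjoint eta a t !=set0 -> normal_fan (adjoint eta a t) = normal_fan P ->
    t <= sl i v + t * k.
  move=> Qn fE; have [x [Qx hx]] := adjoint_vertex ei pr Qn fE vv vf.
  by move/adjointE/(_ i): Qx; rewrite (uq x t hx) slackD.
rewrite leNgt; apply/negP => hlt.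
have k1 : 0 < 1 - k.
  rewrite ltNge; apply/negP => k1; have : la * (1 - k) <= 0 by rewrite mulr_ge0_le0.
  move: hlt; rewrite mulrBr mulr1; lra.
(* The point v + t d satisfies inequality i only for t <= [sl i v / (1 - k)], a bound smaller than
   [la]; some t with equal fans exceeds it. *)
have : ((sl i v / (1 - k))%:E < lambdaP P eta a)%E.
  rewrite -sE laE lte_fin ltr_pdivrMr // mulrBr mulr1; lra.
move=> /ereal_sup_gt[_ [t [t0 [Qn fE]] <-]]; rewrite lte_fin ltr_pdivrMr //.
by have := key t Qn fE; rewrite mulrBr mulr1; lra.
Qed.

End Adjoint.

(** * Codegree and primitive relations *)

Section Codegree.
Context {R : realType} {n : nat}.
Implicit Types P : set 'rV[R]_n.

Lemma codeg_le P c : codeg_pred P c -> (codeg P <= c)%N.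
Proof.
rewrite /codeg; case: pselect => // h Pc; case: ex_minnP => m _; exact.
Qed.

Lemma codegP P c : codeg_pred P c -> codeg_pred P (codeg P).
Proof.
rewrite /codeg; case: pselect => [h|h] Pc; first by case: ex_minnP.
by case: h; exists c.
Qed.

End Codegree.

Lemma sum_fiber (I J : finType) (U : zmodType) (f : J -> I) (b : J -> nat) (F : I -> U) :
  \sum_i F i *+ (\sum_(j | f j == i) b j)%N = \sum_j F (f j) *+ b j.
Proof.
rewrite (partition_big f xpredT) //=; apply: eq_bigr => i _.
rewrite (big_morph _ (mulrnDr (F i)) (mulr0n (F i))).
by apply: eq_bigr => j /eqP ->.
Qed.

(** * Interior lattice points and relations of least weight *)

Section Core.
Context {R : realType} {n r : nat} (P : set 'rV[R]_n).
Context (eta : 'I_r -> 'rV[int]_n) (a : 'I_r -> R) (V : seq 'rV[R]_n) (la : R).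
Hypothesis sp : smooth_pres P eta a V.
Hypothesis n0 : (0 < n)%N.
Hypothesis la0 : 0 <= la.
Hypothesis la_max : forall t, la < t -> ~ (adjoint eta a t !=set0).
Hypothesis la_vertex : forall v f q, vertex P v -> vertex_basis eta a v f ->
  (forall j, slack eta a (f j) q = la) -> adjoint eta a la q.
Local Notation sl := (slack eta a).

Lemma adjoint_ray v f : vertex P v -> vertex_basis eta a v f ->
  exists d, [/\ forall j, dotv (intv R (eta (f j))) d = 1,
    forall t j, sl (f j) (v + t *: d) = t & adjoint eta a la (v + la *: d)].
Proof.
move=> vv vf; have [_ hf fB] := vf; have [d hd] := basis_solve (R := R) fB (fun=> 1).
have hq t j : sl (f j) (v + t *: d) = t.
  by rewrite slackD hd mulr1 ((hf (f j)).2 _) ?add0r //; exists j.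
by exists d; split=> //; apply: (la_vertex vv vf) => j.
Qed.

(** On the segment from v to v + la d every slack is affine, nonnegative at v and at least [la] at
    the other end, so it is at least 1 / c at q = v + d / c. Hence z = c q has distance exactly 1
    from the facets of cP through cv, which makes it a lattice point, and at least 1 from the
    others, which makes it interior. *)
Lemma codeg_predI c : (0 < c)%N -> 1 <= c%:R * la -> codeg_pred P c.
Proof.
move=> c0 cla; apply/asboolP; split=> //.
have [v vv _] := sp_vertex_min sp 0; have [f vf] := sp_basis sp vv.
have [d [hd ht Ad]] := adjoint_ray vv vf; have [_ hf fB] := vf.
have cp : 0 < c%:R :> R by rewrite ltr0n.
pose q := v + c%:R^-1 *: d; pose z := c%:R *: q.
have vtight j : sl (f j) v = 0 by apply/hf; exists j.
have slq i : c%:R^-1 <= sl i q.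
  rewrite /q slackD; set k := dotv _ d.
  have s0 : 0 <= sl i v by apply: (sp_ge0 sp); apply: vertex_mem.
  have : la <= sl i v + la * k by move/adjointE: Ad => /(_ i); rewrite slackD.
  have tla : c%:R^-1 <= la by rewrite -[_^-1]mulr1 ler_pdivrMl.
  have t0 : 0 <= c%:R^-1 :> R by rewrite invr_ge0 ltW.
  by case: (lerP k 1) => k1; nra.
have slz i : 1 <= dotv (intv R (eta i)) z + c%:R * a i.
  by rewrite /z dotvZr -mulrDr -/(sl i q) -ler_pdivrMl // mulr1.
exists z; split.
  apply: (basis_lattice fB) => j.
  have -> : dotv (intv R (eta (f j))) z = 1 - c%:R * a (f j).
    rewrite /z dotvZr; have := ht c%:R^-1 j; rewrite -/q /slack => /(canRL (addrK _)) ->.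
    by rewrite mulrBr mulfV ?gt_eqF.
  rewrite rpredB ?rpred1 // rpredM ?rpred_nat //; exact: (tight_int sp vv (vtight j)).
(* [M] bounds the sum of the absolute coordinates of each normal, so within the box of radius 1 / (1
   + M) every slack changes by at most 1. *)
pose M := \sum_i \sum_j `|intv R (eta i) ord0 j|.
have M0 : 0 < 1 + M by rewrite ltr_pwDl // sumr_ge0 // => i _; apply: sumr_ge0.
exists (1 + M)^-1; split; first by rewrite invr_gt0.
move=> y hy; exists (c%:R^-1 *: y); last by rewrite scalerA mulfV ?scale1r // gt_eqF.
apply/(sp_in sp) => i; rewrite -(pmulr_rge0 _ cp) /slack mulrDr dotvZr mulrA mulfV ?gt_eqF // mul1r.
have -> : dotv (intv R (eta i)) y = dotv (intv R (eta i)) z + dotv (intv R (eta i)) (y - z).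
  by rewrite dotvBr addrC subrK.
suff : `|dotv (intv R (eta i)) (y - z)| <= 1.
  by rewrite ler_norml => /andP[h1 _]; have := slz i; lra.
apply: le_trans (ler_norm_sum _ _ _) _.
apply: (@le_trans _ _ ((1 + M)^-1 * M)); last by rewrite ler_pdivrMl // mulr1 lerDr.
have leM : \sum_j `|intv R (eta i) ord0 j| <= M.
  by rewrite /M (bigD1 i) //= lerDl sumr_ge0 // => k _; exact: sumr_ge0.
apply: le_trans (ler_wpM2l _ leM); last by rewrite invr_ge0 ltW.
rewrite mulr_sumr; apply: ler_sum => j _; rewrite normrM mulrC.
apply: ler_wpM2r => //.
have -> : (y - z) ord0 j = y ord0 j - z ord0 j by rewrite mxE [X in _ + X]mxE.
exact: ltW (hy j).
Qed.

Definition always_tight i := forall x, adjoint eta a la x -> sl i x = la.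

(** Otherwise each facet has a point of the adjoint polytope with slack above [la]; the barycentre
    of these points has all slacks above [la], and the adjoint polytope would survive beyond the
    threshold. *)
Lemma ex_always_tight : exists i, always_tight i.
Proof.
apply: contrapT => /forallNP h.
have hx i : exists x, adjoint eta a la x /\ la < sl i x.
  have /existsNP[x /not_implyP[Ax /eqP sx]] := h i; exists x; split=> //.
  by rewrite lt_neqAle eq_sym sx /=; move/adjointE: Ax.
have [v vv _] := sp_vertex_min sp 0; have [f _] := sp_basis sp vv.
have [X hX] := boolp.choice hx.
pose N : R := r%:R.
have N0 : 0 < N by rewrite ltr0n; apply: leq_ltn_trans (ltn_ord (f (Ordinal n0))).
pose x := \sum_i N^-1 *: X i.
have sumN : \sum_(i < r) N^-1 = 1 by rewrite sumr_const card_ord -mulr_natl divff ?gt_eqF.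
have sx i : 0 < sl i x - la.
  rewrite /x slack_comb // -mulr_sumr -(mulKf (lt0r_neq0 N0) la) -mulrBr pmulr_rgt0 ?invr_gt0 //.
  rewrite mulr_natl -[r in la *+ r]card_ord -sumr_const -sumrB (bigD1 i) //=.
  apply: ltr_pwDl; first by rewrite subr_gt0 (hX i).2.
  by rewrite sumr_ge0 // => k _; rewrite subr_ge0; move/adjointE: (hX k).1.
have [i si|e e0 he] := @small_step R _ (fun i => sl i x - la) (fun=> -1) (fun i => ltW (sx i)).
  by have := sx i; rewrite si ltxx.
apply: (la_max (t := la + e)); first by rewrite ltrDl.
exists x; apply/adjointE => i; have := he i; lra.
Qed.

Definition tight_relation (N : 'I_r -> nat) :=
  \sum_i eta i *+ N i = 0 /\ forall i, N i != 0%N -> always_tight i.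

(** Minimising w over P selects a vertex cone containing w. The values of w at x and at v + la d
    agree, and their difference is the sum of the nonnegative terms [b j] times (slack at x minus
    [la]), so every term vanishes. *)
Lemma tight_decomposition (w : 'rV[int]_n) :
  (forall x x', adjoint eta a la x -> adjoint eta a la x' ->
     dotv (intv R w) x = dotv (intv R w) x') ->
  exists v f b, [/\ vertex P v, vertex_basis eta a v f,
    w = \sum_j eta (f j) *+ b j & forall j, b j != 0%N -> always_tight (f j)].
Proof.
move=> wc; have [v vv vmin] := sp_vertex_min sp (intv R w).
have [f vf] := sp_basis sp vv; have [_ hf fB] := vf.
have [b bE] := basis_coord_int fB w.
have bER : intv R w = \sum_j (b j)%:~R *: intv R (eta (f j)).
  by rewrite bE intv_sum; apply: eq_bigr => j _; rewrite intvZ.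
have b0 j : 0 <= b j by rewrite -(ler0z R); apply: (min_coord sp (vertex_mem vv) vf bER).
exists v, f, (fun j => `|b j|%N); split=> //.
  by rewrite {1}bE; apply: eq_bigr => j _; rewrite -{1}(gez0_abs (b0 j)) -scaler_nat natz.
move=> j bj x Ax; have [d [hd ht Ad]] := adjoint_ray vv vf.
have /eqP : \sum_k (b k)%:~R * (sl (f k) x - la) = 0.
  transitivity (dotv (intv R w) x - dotv (intv R w) (v + la *: d)); last first.
    by rewrite (wc _ _ Ax Ad) subrr.
  rewrite bER !dotv_suml -sumrB; apply: eq_bigr => k _.
  rewrite !dotvZl -mulrBr -[la in LHS](ht la k) /slack; congr (_ * _).
  by rewrite opprD addrACA subrr addr0.
rewrite psumr_eq0 => [|k _]; last first.
  by rewrite mulr_ge0 ?ler0z // subr_ge0; move/adjointE: Ax.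
move=> /allP/(_ j (mem_index_enum _)) /=.
by rewrite mulf_eq0 intr_eq0 -absz_eq0 (negPf bj) /= subr_eq0 => /eqP.
Qed.

(** Decompose [- eta i0] for an always tight [i0] and bring [eta i0] to the same side. *)
Lemma ex_tight_relation : exists2 N, tight_relation N & (0 < \sum_i N i)%N.
Proof.
have [i0 ti0] := ex_always_tight.
have [x x' Ax Ax'|v [f [b [vv vf wE tb]]]] := @tight_decomposition (- eta i0).
  rewrite !intvN !dotvNl; congr (- _).
  by have := ti0 x Ax; rewrite -(ti0 x' Ax') /slack => /addIr.
exists (fun i => (i == i0) + \sum_(j | f j == i) b j)%N; last first.
  by rewrite (bigD1 i0) //= eqxx.
split.
  under eq_bigr do rewrite mulrnDr.
  rewrite big_split /= sum_fiber -wE (bigD1 i0) //= eqxx big1 ?addr0 ?subrr //.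
  by move=> i /negPf ->.
move=> i; have [->//|_] := eqVneq i i0; rewrite add0n sum_nat_eq0.
by move=> /forallPn[j]; rewrite negb_imply => /andP[/eqP <- /tb].
Qed.

(** For a smooth polytope these are the sets of normals spanning a cone of the normal fan; the
    minimal sets that fail this are Batyrev's primitive collections. *)
Definition face (A : {set 'I_r}) := exists v, vertex P v /\ forall i, i \in A -> sl i v = 0.

(** A decomposition of the sum over S at a vertex v has weight at least [#|S|] only if all facets of
    S are tight at v, which a non-face excludes. Least weight of the relation then forces the
    decomposition to be empty, so the sum is 0. *)
Lemma ex_primitive_relation : exists S : {set 'I_r}, [/\ \sum_(i in S) eta i = 0, ~ face S,
  forall i, i \in S -> face (S :\ i) & forall i, i \in S -> always_tight i].
Proof.
pose Q m := `[< exists N, [/\ tight_relation N, m = (\sum_i N i)%N & (0 < m)%N] >].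
have exQ : exists m, Q m.
  by have [N tN N0] := ex_tight_relation; exists (\sum_i N i)%N; apply/asboolP; exists N.
case: (ex_minnP exQ) => m /asboolP[N [[NE tN] mE m0]] minm.
pose supp := [set i | N i != 0%N]%SET.
(* At a vertex on all facets of the support, the direction d has value 1 on each of their normals,
   so the relation would have weight 0. *)
have nfs : ~ face supp.
  move=> [v [vv hv]]; have [f vf] := sp_basis sp vv; have [_ hf _] := vf.
  have [d [hd _ _]] := adjoint_ray vv vf.
  have : dotv (intv R (\sum_i eta i *+ N i)) d = 0 by rewrite NE intv0 dotv0l.
  rewrite intv_sum dotv_suml (eq_bigr (fun i => (N i)%:R)) => [|i _].
    by rewrite -natr_sum -mE => /eqP; rewrite pnatr_eq0 -leqn0 leqNgt m0.
  have [->|Ni] := eqVneq (N i) 0%N; first by rewrite mulr0n intv0 dotv0l.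
  rewrite intvMn dotvZl.
  have [j <-] : exists j, f j = i by apply/hf/hv; rewrite inE.
  by rewrite hd mulr1.
have [S minS] : {S | minset (fun A => `[< ~ face A >] && (A \subset supp)) S}.
  by apply: ex_minset; exists supp; rewrite subxx andbT; apply/asboolP.
have [/andP[/asboolP nS Ssub] Smin] := minsetP minS.
have tS i : i \in S -> always_tight i by move=> /(fintype.subsetP Ssub); rewrite inE => /tN.
have fS i : i \in S -> face (S :\ i).
  move=> iS; apply: contrapT => nf; have /Smin : `[< ~ face (S :\ i) >] && (S :\ i \subset supp).
    by apply/andP; split; [apply/asboolP | apply: fintype.subset_trans Ssub; apply: finset.subsetDl].
  by move=> /(_ (finset.subsetDl _ _)) SE; move: iS; rewrite -SE !inE eqxx.
exists S; split=> //; set w := \sum_(i in S) eta i.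
have wR x : dotv (intv R w) x = \sum_(i in S) (sl i x - a i).
  by rewrite /w intv_sum dotv_suml; apply: eq_bigr => i _; rewrite /slack addrK.
have [x x' Ax Ax'|v [f [b [vv vf wE tb]]]] := @tight_decomposition w.
  by rewrite !wR; apply: eq_bigr => i iS; rewrite !(tS i).
have [d [hd ht Ad]] := adjoint_ray vv vf.
have lt : (\sum_j b j < #|S|)%N.
  (* Both sides are the growth of w from v to v + la d: each basis normal gains [la], and each slack
     in S rises from its value at v to [la]. *)
  have E : la * (\sum_j b j)%:R = la * #|S|%:R - \sum_(i in S) sl i v.
    transitivity (dotv (intv R w) (v + la *: d) - dotv (intv R w) v).
      rewrite -dotvBr addrAC subrr add0r dotvZr; congr (_ * _).
      rewrite wE intv_sum dotv_suml natr_sum; apply: eq_bigr => j _.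
      by rewrite intvMn dotvZl hd mulr1.
    rewrite !wR -sumrB mulr_natr -sumr_const -sumrB; apply: eq_bigr => i iS.
    by rewrite (tS i iS) //; ring.
  have pos : 0 < \sum_(i in S) sl i v.
    have s0 i : 0 <= sl i v by apply: (sp_ge0 sp); apply: vertex_mem.
    rewrite lt_neqAle sumr_ge0 // andbT eq_sym; apply/eqP => /eqP.
    rewrite psumr_eq0 // => /allP h; apply: nS; exists v; split=> // i iS.
    by apply/eqP; have := h i (mem_index_enum _); rewrite iS.
  rewrite -(ltr_nat R) ltNge; apply/negP => h.
  by have := ler_wpM2l la0 h; rewrite E; lra.
(* Replacing the sum over [S] by its expression in the cone containing it lowers the weight. *)
pose Nf i := (\sum_(j | f j == i) b j)%N.
pose N' i := (N i - (i \in S) + Nf i)%N.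
have NS i : ((i \in S) <= N i)%N.
  by case iS: (i \in S) => //; move: iS => /(fintype.subsetP Ssub); rewrite inE lt0n.
have sumNf : (\sum_i Nf i = \sum_j b j)%N by rewrite [RHS](partition_big f xpredT).
have sumN' : (\sum_i N' i + #|S| = m + \sum_j b j)%N.
  rewrite mE -sumNf -sum1_card [X in (_ + X = _)%N]big_mkcond -!big_split /=; apply: eq_bigr => i _.
  by rewrite /N'; have := NS i; case: (i \in S); lia.
have tN' : tight_relation N'.
  split.
    apply: (addIr w); rewrite add0r.
    transitivity (\sum_i eta i *+ N i + \sum_i eta i *+ Nf i); last first.
      by rewrite NE add0r sum_fiber -wE.
    rewrite /w [X in _ + X]big_mkcond -!big_split /=; apply: eq_bigr => i _.
    rewrite -mulrnDr /N'; have := NS i; case: (i \in S) => iN; last by rewrite subn0 addr0.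
    by rewrite -mulrSr; congr (_ *+ _); lia.
  move=> i; rewrite addn_eq0 negb_and => /orP[h|]; last first.
    by rewrite sum_nat_eq0 => /forallPn[j]; rewrite negb_imply => /andP[/eqP <- /tb].
  by apply: tN; move: h; case: (N i).
have N'0 : (\sum_i N' i = 0)%N.
  apply/eqP; rewrite -leqn0 leqNgt; apply/negP => N'0.
  have : Q (\sum_i N' i)%N by apply/asboolP; exists N'.
  by move=> /minm; lia.
rewrite wE -(sum_fiber f b eta); apply: big1 => i _.
have /eqP := N'0; rewrite sum_nat_eq0 => /forallP/(_ i) /=; rewrite addn_eq0 => /andP[_ /eqP].
by rewrite /Nf => ->.
Qed.

(** The direction d has value 1 on a lattice basis of normals at v, hence an integral value on
    [eta i]; the slack grows from v to [la] by [la] times this integer. *)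
Lemma tight_slack_mult i v : always_tight i -> vertex P v ->
  exists z : int, sl i v = la * z%:~R.
Proof.
move=> ti vv; have [f vf] := sp_basis sp vv; have [_ _ fB] := vf.
have [d [hd _ Ad]] := adjoint_ray vv vf; have [b bE] := basis_coord_int fB (eta i).
exists (1 - \sum_j b j); have := ti _ Ad; rewrite slackD.
have -> : dotv (intv R (eta i)) d = (\sum_j b j)%:~R.
  rewrite bE intv_sum dotv_suml rmorph_sum; apply: eq_bigr => j _.
  by rewrite intvZ dotvZl hd mulr1.
rewrite rmorphB /= mulrBr mulr1; lra.
Qed.

End Core.

(** * Generalized Cayley structure *)

Section Transfer.
Context {R : realType} {n r : nat}.

Definition affmap (A : 'M[int]_n) (b : 'rV[int]_n) (x : 'rV[R]_n) : 'rV[R]_n :=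
  x *m map_mx (fun z : int => z%:~R) A + intv R b.

Lemma affmap_comb A b k (w : 'I_k -> R) p : \sum_i w i = 1 ->
  affmap A b (\sum_i w i *: p i) = \sum_i w i *: affmap A b (p i).
Proof.
move=> w1; rewrite /affmap mulmx_suml; under [RHS]eq_bigr do rewrite scalerDr.
rewrite big_split /= -scaler_suml w1 scale1r; congr (_ + _).
by apply: eq_bigr => i _; rewrite scalemxAl.
Qed.

Lemma affmap_mid A b x y : affmap A b (2^-1 *: (x + y)) = 2^-1 *: (affmap A b x + affmap A b y).
Proof. rewrite /affmap -scalemxAl mulmxDl; apply/rowP => j; rewrite !mxE; lra. Qed.

Lemma affmap_lattice A b x : lattice_pt x -> lattice_pt (affmap A b x).
Proof.
move=> xl j; rewrite !mxE rpredD ?intr_int // rpred_sum // => k _.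
by rewrite mxE rpredM ?intr_int.
Qed.

Context (A : 'M[int]_n) (b : 'rV[int]_n).
Hypothesis uA : A \in unitmx.
Local Notation Phi := (affmap A b).
Let AR : 'M[R]_n := map_mx (fun z : int => z%:~R) A.
Let IR : 'M[R]_n := map_mx (fun z : int => z%:~R) (invmx A).

Let AI : AR *m IR = 1%:M.
Proof. by rewrite -(map_mxM (intr : int -> R)) mulmxV // map_mx1. Qed.
Let IA : IR *m AR = 1%:M.
Proof. by rewrite -(map_mxM (intr : int -> R)) mulVmx // map_mx1. Qed.

Definition affinv (y : 'rV[R]_n) : 'rV[R]_n := (y - intv R b) *m IR.

Lemma affmapK : cancel Phi affinv.
Proof. by move=> x; rewrite /affinv /affmap addrK -mulmxA AI mulmx1. Qed.

Lemma affinvK : cancel affinv Phi.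
Proof. by move=> x; rewrite /affinv /affmap -mulmxA IA mulmx1 subrK. Qed.

Context (P : set 'rV[R]_n) (eta : 'I_r -> 'rV[int]_n) (a : 'I_r -> R) (V : seq 'rV[R]_n).

Definition transfer_normal i := eta i *m (invmx A)^T.
Definition transfer_offset i := a i - dotv (intv R (transfer_normal i)) (intv R b).

Lemma transfer_slack i x :
  slack transfer_normal transfer_offset i (Phi x) = slack eta a i x.
Proof.
rewrite /slack /transfer_offset [in LHS]/affmap dotvDr addrACA subrr addr0.
congr (_ + _).
have E : map_mx (intr : int -> R) (invmx A)^T *m AR^T = 1%:M.
  by rewrite map_trmx -map_mxM -trmx_mul mulmxV // trmx1 map_mx1.
rewrite !dotvE /transfer_normal /intv (map_mxM (intr : int -> R)) trmx_mul mulmxA.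
by rewrite -[_ *m _ *m AR^T]mulmxA E mulmx1.
Qed.

Lemma transfer_vertex v : vertex P v -> vertex (Phi @` P) (Phi v).
Proof.
move=> [Pv hv]; split; first by exists v.
move=> _ _ [x Px <-] [y Py <-] vE; congr Phi; apply: hv => //.
rewrite -[v]affmapK vE -[RHS]affmapK; congr affinv.
by rewrite affmap_mid.
Qed.

Lemma transfer_vertex_inv y : vertex (Phi @` P) y -> vertex P (affinv y).
Proof.
move=> [[v Pv <-] hv]; rewrite affmapK; split=> // x z Px Pz vE.
apply: (can_inj affmapK); apply: hv; [by exists x | by exists z |].
by rewrite vE affmap_mid.
Qed.

Lemma transfer_smooth : smooth_pres P eta a V ->
  smooth_pres (Phi @` P) transfer_normal transfer_offset (map Phi V).
Proof.
move=> sp; split.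
- apply/seteqP; split=> [_ [x Px <-] i|y hy]; first by rewrite transfer_slack (sp_ge0 sp).
  exists (affinv y); last exact: affinvK.
  by apply/(sp_in sp) => i; rewrite -transfer_slack affinvK.
- by move=> _ /mapP[v vV ->]; apply/affmap_lattice/(sp_lat sp).
- apply/seteqP; split=> [_ [x Px <-]|y [k [w [p [Vp [w0 [w1 ->]]]]]]].
    move: Px; rewrite (sp_conv sp) => -[k [w [p [Vp [w0 [w1 ->]]]]]].
    exists k, w, (fun i => Phi (p i)); rewrite affmap_comb //; split=> // i.
    exact: (map_f _ (Vp i)).
  exists (\sum_i w i *: affinv (p i)).
    rewrite (sp_conv sp); exists k, w, (fun i => affinv (p i)); split=> // i.
    by have /= /mapP[v vV ->] := Vp i; rewrite affmapK.
  by rewrite affmap_comb //; apply: eq_bigr => i _; rewrite affinvK.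
- move=> y vy; have [f [fi hf fB]] := sp_basis sp (transfer_vertex_inv vy).
  exists f; split=> // [i|]; first by rewrite -hf -transfer_slack affinvK.
  have -> : \matrix_j transfer_normal (f j) = (\matrix_j eta (f j)) *m (invmx A)^T.
    by apply/row_matrixP => j; rewrite row_mul !rowK.
  by rewrite unitmx_mul fB unitmx_tr unitmx_inv.
- by have [x Px] := sp_nonempty sp; exists (Phi x); exists x.
Qed.

Lemma transfer_iso : lattice_iso P (Phi @` P).
Proof. by exists A, b. Qed.

End Transfer.

(** The slacks of the n facets through v are integral affine coordinates: their normals form a
    lattice basis, and their offsets are integers since v is a lattice point. *)
Lemma standard_position {R : realType} n r (P : set 'rV[R]_n) (eta : 'I_r -> 'rV[int]_n) a V v g :
  smooth_pres P eta a V -> vertex P v -> vertex_basis eta a v g ->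
  exists P' eta' a' V' (Phi : 'rV[R]_n -> 'rV[R]_n),
  [/\ lattice_iso P P', smooth_pres P' eta' a' V',
      (forall i x, slack eta' a' i (Phi x) = slack eta a i x),
      (forall j x, slack eta' a' (g j) x = x ord0 j) &
      [/\ forall x, vertex P x -> vertex P' (Phi x),
          forall y, vertex P' y -> exists2 x, vertex P x & y = Phi x &
          forall p (x : 'I_p -> 'I_r), \sum_i eta (x i) = 0 -> \sum_i eta' (x i) = 0]].
Proof.
move=> sp vv [gi hg gB].
have ag j : exists z : int, z%:~R = a (g j).
  have /(tight_int sp vv)/intrP[z zE] : slack eta a (g j) v = 0 by apply/hg; exists j.
  by exists z.
have [b bE] := boolp.choice ag.
pose A := (\matrix_j eta (g j))^T.
have uA : A \in unitmx by rewrite unitmx_tr.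
pose B := \row_j b j.
exists (affmap A B @` P), (transfer_normal A eta), (transfer_offset A B eta a), (map (affmap A B) V),
  (affmap A B).
split; [exact: transfer_iso | exact: transfer_smooth | by move=> i x; apply: transfer_slack | |].
  move=> j x; have nE : transfer_normal A eta (g j) = delta_mx ord0 j.
    have gE : eta (g j) = row j A^T by rewrite trmxK rowK.
    by rewrite /transfer_normal gE -row_mul -trmx_mul mulVmx // trmx1 row1.
  rewrite /slack /transfer_offset nE intv_delta !dotv_delta !mxE -bE; ring.
split.
- by move=> x; apply: transfer_vertex.
- move=> y vy; exists (affinv A B y); first exact: transfer_vertex_inv.
  by rewrite affinvK.
- by move=> p x h; rewrite -mulmx_suml h mul0mx.
Qed.

(** * Fibres over the vertices of a dilated simplex *)

Section CayleyStructure.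
Context {R : realType} {m p r : nat} (P : set 'rV[R]_(m + p)).
Context (eta : 'I_r -> 'rV[int]_(m + p)) (a : 'I_r -> R) (V : seq 'rV[R]_(m + p)).
Context (x : 'I_p.+1 -> 'I_r) (s : nat).
Hypothesis sp : smooth_pres P eta a V.
Local Notation sl := (slack eta a).
Hypothesis x_coord : forall i z, sl (x (lift ord0 i)) z = z ord0 (rshift m i).
Hypothesis x_sum : forall z, \sum_i sl (x i) z = s%:R.
Hypothesis x_vertex : forall v, vertex P v -> exists i, sl (x i) v = s%:R.

(** The point projects to vertex i of the dilated simplex, where index 0 is the origin. *)
Definition lies_over i (z : 'rV[R]_(m + p)) := forall j, sl (x j) z = if j == i then s%:R else 0.

Lemma overP i z : lies_over i z <-> rsubmx z = cayley_e R s i.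
Proof.
split=> [h|zE].
  by apply/rowP => j; rewrite mxE [RHS]mxE -x_coord h.
have hl j : sl (x (lift ord0 j)) z = if lift ord0 j == i then s%:R else 0.
  by rewrite x_coord; have /rowP/(_ j) := zE; rewrite mxE => ->; rewrite mxE.
move=> j; have [k ->|->] := unliftP ord0 j; first exact: hl.
have e1 := x_sum z; rewrite big_ord_recl (eq_bigr _ (fun j _ => hl j)) in e1.
have e2 : \sum_j (if j == i then s%:R else 0) = s%:R :> R by rewrite -big_mkcond big_pred1_eq.
rewrite big_ord_recl in e2.
by apply: (addIr (\sum_(k < p) (if lift ord0 k == i then s%:R else 0))); rewrite e1 e2.
Qed.

Lemma over_max i z : P z -> sl (x i) z = s%:R -> lies_over i z.
Proof.
move=> Pz zi j; case: eqP => [->//|/eqP ji].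
have := x_sum z; rewrite (bigD1 i) //= zi => /(canRL (addKr _)); rewrite addNr => /eqP.
rewrite psumr_eq0 => [|k _]; last exact: (sp_ge0 sp).
by move=> /allP/(_ j (mem_index_enum _)); rewrite ji => /eqP.
Qed.

Lemma over_vertex v : vertex P v -> exists i, lies_over i v.
Proof. by move=> vv; have [i vi] := x_vertex vv; exists i; apply: over_max vi; case: vv. Qed.

(** Leave v along the edge on which [x j] alone of the tight facets is lost, then pass to a vertex
    of P that keeps the facets tight there and does not decrease the slack at [x j]. This slack is
    positive, so the new vertex can lie over j only. *)
Lemma over_neighbour v i j : vertex P v -> lies_over i v -> exists v', [/\ vertex P v', lies_over j v' &
  forall k, (forall l, x l != k) -> sl k v = 0 -> sl k v' = 0].
Proof.
move=> vv vi; have [->|ji] := eqVneq j i; first by exists v.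
have [f vf] := sp_basis sp vv; have [fi hf fB] := vf.
have [l0 l0E] : exists l, f l = x j by apply/hf; rewrite vi (negPf ji).
have [d hd] := basis_dual (R := R) fB l0.
have [l|e e0 Pe] := vertex_dir (d := d) sp (vertex_mem vv) vf; first by rewrite hd; case: eqP.
have [v' [vv' wv' hv']] := sp_vertex_below sp (- intv R (eta (x j))) Pe.
have [j' v'j'] := over_vertex vv'.
exists v'; split=> //.
  suff -> : j = j' by [].
  apply/eqP; apply: contraTT isT => jj'.
  have := v'j' j; rewrite (negPf jj') => s1.
  have : sl (x j) (v + e *: d) = e.
    by rewrite slackD vi (negPf ji) add0r -l0E hd eqxx mulr1.
  move=> s2; have : e <= sl (x j) v' by rewrite -s2 /slack lerD2r -lerN2 -!dotvNl.
  by rewrite s1 leNgt e0.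
move=> k xk vk; apply: hv'; have /hf[l lk] := vk.
rewrite slackD vk -lk hd add0r; case: eqP => [ll|]; last by rewrite mulr0.
by have := xk j; rewrite -l0E -ll lk eqxx.
Qed.

Lemma ex_over_vertex i : exists2 v, vertex P v & lies_over i v.
Proof.
have [v vv _] := sp_vertex_min sp 0; have [j vj] := over_vertex vv.
by have [v' [vv' v'i _]] := over_neighbour i vv vj; exists v'.
Qed.

Lemma over_basis v v' i : vertex P v -> lies_over i v -> lies_over i v' ->
  (forall k, (forall l, x l != k) -> sl k v = 0 -> sl k v' = 0) -> v' = v.
Proof.
move=> vv vi v'i h; have [f vf] := sp_basis sp vv; apply: (vertex_basis_inj vf) => j.
have [_ hf _] := vf; have fj : sl (f j) v = 0 by apply/hf; exists j.
have [[l lE]|/forallNP hx] := pselect (exists l, x l = f j); last first.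
  by apply: h => // l; apply/eqP/hx.
move: fj; rewrite -lE vi v'i; by case: eqP.
Qed.

Definition cayley_fibre i : set 'rV[R]_m := [set z | P (row_mx z (cayley_e R s i))].

Lemma over_fibre v i : P v -> lies_over i v ->
  v = row_mx (lsubmx v) (cayley_e R s i) /\ cayley_fibre i (lsubmx v).
Proof.
move=> Pv /overP vi; have vE : v = row_mx (lsubmx v) (cayley_e R s i) by rewrite -vi hsubmxK.
by split=> //; rewrite /cayley_fibre /= -vE.
Qed.

Lemma fibre_over i z : lies_over i (row_mx z (cayley_e R s i)).
Proof. by apply/overP; rewrite row_mxKr. Qed.

Lemma dotv_row_mx (u z : 'rV[R]_m) (u' z' : 'rV[R]_p) :
  dotv (row_mx u u') (row_mx z z') = dotv u z + dotv u' z'.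
Proof.
rewrite /dotv big_split_ord /=; congr (_ + _); apply: eq_bigr => i _.
  by rewrite !row_mxEl.
by rewrite !row_mxEr.
Qed.

Lemma dotv_row_mx0 (u z : 'rV[R]_m) (z' : 'rV[R]_p) : dotv (row_mx u 0) (row_mx z z') = dotv u z.
Proof. by rewrite dotv_row_mx dotv0l addr0. Qed.

(* The condition depends on [v] only through its tight facets outside the family [x]. *)
Definition fibre_cone (u : 'rV[R]_m) v := exists c : 'I_r -> R,
  (forall k, (forall l, x l != k) -> 0 <= c k /\ (c k != 0 -> sl k v = 0)) /\
  row_mx u 0 = \sum_k c k *: intv R (eta k).

(** The normals of the family [x] are constant on the fibre, so they may enter with any real
    coefficient. The other coefficients are nonnegative because the edge directions dual to facets
    outside the family stay within the fibre. *)
Lemma fibre_coneP u v i : vertex P v -> lies_over i v ->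
  (forall z, cayley_fibre i z -> dotv u (lsubmx v) <= dotv u z) <-> fibre_cone u v.
Proof.
move=> vv vi; have Pv := vertex_mem vv; have [vE vfib] := over_fibre Pv vi.
split=> [umin|[c [hc uE]] z Pz]; last first.
  rewrite -(dotv_row_mx0 u z (cayley_e R s i)) -(dotv_row_mx0 u _ (cayley_e R s i)) -vE.
  rewrite uE !dotv_suml; apply: ler_sum => k _; rewrite !dotvZl.
  have [[l <-]|/forallNP hx] := pselect (exists l, x l = k).
    have : sl (x l) v = sl (x l) (row_mx z (cayley_e R s i)) by rewrite vi fibre_over.
    by move=> /addIr ->.
  have [|ck0 ckv] := hc k; first by move=> l; apply/eqP/hx.
  have [->|/ckv vk] := eqVneq (c k) 0; first by rewrite !mul0r.
  rewrite ler_wpM2l // -(lerD2r (a k)) -/(sl k v) vk.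
  exact: (sp_ge0 sp).
have [f vf] := sp_basis sp vv; have [fi hf fB] := vf.
have [b bE] := basis_coord (R := R) fB (row_mx u 0).
have bpos j : (forall l, x l != f j) -> 0 <= b j.
  move=> xj; have [d hd] := basis_dual (R := R) fB j.
  have [l|e e0 Pe] := vertex_dir (d := d) sp Pv vf; first by rewrite hd; case: eqP.
  have ei : lies_over i (v + e *: d).
    have z l : l != i -> sl (x l) (v + e *: d) = 0.
      move=> li; have vl : sl (x l) v = 0 by rewrite vi (negPf li).
      have [k kE] := (hf _).1 vl; rewrite slackD vl add0r -kE hd.
      by case: eqP => [kj|]; rewrite ?mulr0 //; have := xj l; rewrite -kE kj eqxx.
    apply: over_max => //; have := x_sum (v + e *: d).
    by rewrite (bigD1 i) //= big1 ?addr0.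
  have [eE efib] := over_fibre Pe ei; have := umin _ efib.
  rewrite -(dotv_row_mx0 u _ (cayley_e R s i)) -(dotv_row_mx0 u (lsubmx (_ + _)) (cayley_e R s i)).
  rewrite -vE -eE dotvDr lerDl dotvZr pmulr_rge0 // bE dotv_suml (bigD1 j) //= big1.
    by rewrite dotvZl hd eqxx mulr1 addr0.
  by move=> k kj; rewrite dotvZl hd (negPf kj) mulr0.
exists (fun k => \sum_(j | f j == k) b j); split.
  move=> k xk; split; first by rewrite sumr_ge0 // => j /eqP fj; apply: bpos; rewrite fj.
  have [[j <-] _|/forallNP hk] := pselect (exists j, f j = k); first by apply/hf; exists j.
  by rewrite big1 ?eqxx // => j /eqP /hk.
rewrite bE (partition_big f xpredT) //=; apply: eq_bigr => k _.
by rewrite scaler_suml; apply: eq_bigr => j /eqP ->.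
Qed.

Lemma sum_row_mx k (F : 'I_k -> 'rV[R]_m) (G : 'I_k -> 'rV[R]_p) :
  \sum_j row_mx (F j) (G j) = row_mx (\sum_j F j) (\sum_j G j).
Proof.
apply: (big_rec3 (fun u v w => w = row_mx u v)); first by rewrite row_mx0.
by move=> j u v w _ ->; rewrite add_row_mx.
Qed.

(** The fibre is the face of P where the slacks at all [x l], l != i, vanish, so its points are
    convex combinations of vertices of P on that face. *)
Lemma fibre_conv i : cayley_fibre i =
  conv [set z | exists v, [/\ vertex P v, lies_over i v & z = lsubmx v]].
Proof.
apply/seteqP; split=> [z Pz|z [k [w [q [hq [w0 [w1 zE]]]]]]].
  have Pc : P = conv [set v | v \in V /\ vertex P v].
    by rewrite {1}(sp_conv sp) conv_vertices -(sp_conv sp).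
  have := Pz; rewrite /cayley_fibre /= {1}Pc => /conv_face[k [w [q [hq [w0 [w1 zE]]]]]].
  exists k, w, (fun j => lsubmx (q j)); split; last first.
    split=> //; split=> //; transitivity (lsubmx (row_mx z (cayley_e R s i))).
      by rewrite row_mxKl.
    by rewrite zE linear_sum; apply: eq_bigr => j _; exact: linearZ.
  move=> j /=; have [[_ vq] hqj] := hq j; exists (q j); split=> //.
  have qP := vertex_mem vq.
  have z_l l : l != i -> sl (x l) (q j) = 0.
    move=> li; have z0 : sl (x l) (row_mx z (cayley_e R s i)) = 0.
      by rewrite fibre_over (negPf li).
    rewrite -z0 /slack; congr (_ + _); apply: hqj => y [_ vy].
    have := sp_ge0 sp (x l) (vertex_mem vy); rewrite -z0 /slack; lra.
  by apply: over_max => //; have := x_sum (q j); rewrite (bigD1 i) //= big1 ?addr0.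
rewrite /cayley_fibre /=.
have -> : row_mx z (cayley_e R s i) = \sum_j w j *: row_mx (q j) (cayley_e R s i).
  under eq_bigr do rewrite scale_row_mx.
  by rewrite sum_row_mx -scaler_suml w1 scale1r -zE.
apply: (sp_convex sp (S := P)) => //; exists k, w, (fun j => row_mx (q j) (cayley_e R s i)).
split=> // j; have [v [vv vi ->]] := hq j.
by have [<- _] := over_fibre (vertex_mem vv) vi; apply: vertex_mem.
Qed.

Lemma fibre_lattice i : lattice_polytope (cayley_fibre i).
Proof.
exists [seq lsubmx v | v <- V & `[< vertex P v /\ lies_over i v >]]; split.
  move=> z /mapP[v]; rewrite mem_filter => /andP[_ /(sp_lat sp) vl] -> j.
  by rewrite mxE; apply: vl.
rewrite fibre_conv; congr conv; apply/seteqP; split=> z /=.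
  move=> [v [vv vi ->]]; apply/mapP; exists v => //; rewrite mem_filter.
  apply/andP; split; first exact/asboolP.
  by move: vv; rewrite (sp_conv sp) => /vertex_in_conv.
by move=> /mapP[v]; rewrite mem_filter => /andP[/asboolP[vv vi] _] ->; exists v.
Qed.

(** From a vertex over i one moves within the fibre away from all tight facets outside the family.
    Halfway along only facets of the family are tight; their slacks ignore the first m coordinates,
    so small steps in these coordinates stay in P. *)
Lemma fibre_full i : full_dim (cayley_fibre i).
Proof.
have [v vv vi] := ex_over_vertex i; have Pv := vertex_mem vv.
have [f vf] := sp_basis sp vv; have [fi hf fB] := vf.
have [d hd] := basis_solve (R := R) fB (fun j => if `[< exists l, x l = f j >] then 0 else 1).
have [l|e e0 Pe] := vertex_dir (d := d) sp Pv vf; first by rewrite hd; case: ifP.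
have xd l : dotv (intv R (eta (x l))) d = 0.
  have lz l' : l' != i -> dotv (intv R (eta (x l'))) d = 0.
    move=> li; have [k kE] : exists k, f k = x l' by apply/hf; rewrite vi (negPf li).
    by rewrite -kE hd asboolT //; exists l'; rewrite kE.
  (* The slack sum of the family is constant, so d preserves the slack at [x i] once it preserves
     all the others. *)
  have [->|/lz//] := eqVneq l i.
  have e1 : \sum_l (sl (x l) v + dotv (intv R (eta (x l))) d) = s%:R.
    by rewrite -[RHS](x_sum (v + 1 *: d)); apply: eq_bigr => l' _; rewrite slackD mul1r.
  rewrite big_split /= x_sum (bigD1 i) //= (big1 _ _ _ lz) addr0 in e1.
  by apply: (addrI s%:R); rewrite e1 addr0.
pose c := v + (e / 2) *: d.
have cE k : sl k c = (sl k v + sl k (v + e *: d)) / 2.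
  by rewrite !slackD; field.
have c0 k : 0 <= sl k c.
  by rewrite cE divr_ge0 // addr_ge0 // (sp_ge0 sp).
have cpos k : sl k c = 0 -> exists l, x l = k.
  move=> ck; have s1 := sp_ge0 sp k Pv; have s2 := sp_ge0 sp k Pe.
  have vk : sl k v = 0 by move: ck; rewrite cE => ?; lra.
  have [j jk] := (hf _).1 vk; have := ck; rewrite slackD vk add0r -jk hd.
  by case: asboolP => // _ /eqP; rewrite mulr1 mulf_eq0 invr_eq0 pnatr_eq0 (gt_eqF e0).
have ci : lies_over i c by move=> l; rewrite slackD xd mulr0 addr0 vi.
pose D (j : 'I_m) : 'rV[R]_(m + p) := row_mx (delta_mx ord0 j) 0.
have oD z t j : lies_over i z -> lies_over i (z + t *: D j).
  by move=> /overP zi; apply/overP; rewrite raddfD /= zi linearZ /= row_mxKr scaler0 addr0.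
have [|e' e'0 he'] := @small_step R ('I_r * 'I_m)%type (fun kj => sl kj.1 c)
    (fun kj => dotv (intv R (eta kj.1)) (D kj.2)) (fun kj => c0 kj.1).
  move=> [k j] /= /cpos[l <-]; have := oD c 1 j ci l; rewrite slackD ci mul1r.
  by move=> /(canRL (addKr _)); rewrite addNr => ->.
have Pc : P c by apply/(sp_in sp).
have PD j : P (c + e' *: D j) by apply/(sp_in sp) => k; rewrite slackD (he' (k, j)).
exists (fun k => if unlift ord0 k is Some j then lsubmx (c + e' *: D j) else lsubmx c); split.
  move=> k; case: unliftP => [j _|_]; first by have [] := over_fibre (PD j) (oD c e' j ci).
  by have [] := over_fibre Pc ci.
set M := (X in row_free X); have -> : M = e'%:M.
  apply/row_matrixP => j; rewrite rowK liftK unlift_none raddfD /= addrAC subrr add0r.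
  rewrite linearZ /= row_mxKl; apply/rowP => l; rewrite !mxE eqxx /= eq_sym.
  by case: eqP; rewrite ?mulr1 ?mulr0.
by rewrite row_free_unit -scalemx1 unitmxZ ?unitmx1 // unitfE gt_eqF.
Qed.

(** It suffices to test w at vertices of the face of u. The cone at such a vertex depends only on
    its tight facets outside the family, which can be carried to another fibre. *)
Lemma fibre_fan_sub i j u w :
  normal_cone (cayley_fibre i) (face_min (cayley_fibre i) u) w ->
  normal_cone (cayley_fibre j) (face_min (cayley_fibre j) u) w.
Proof.
move=> wi z y [zj zmin] yj.
have := zj; rewrite {1}fibre_conv => /conv_face[k [c [q [hq [c0 [c1 zE]]]]]].
suff hw l : dotv w (q l) <= dotv w y.
  rewrite zE dotv_comb -[dotv w y]mul1r -c1 mulr_suml; apply: ler_sum => l _.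
  by rewrite ler_wpM2l.
have [[v [vv vj qE]] ql] := hq l; rewrite {}qE in ql *.
have qmin t : cayley_fibre j t -> dotv u (lsubmx v) <= dotv u t.
  move=> tj; rewrite ql; first exact: zmin.
  by move=> _ [v' [vv' v'j ->]]; apply: zmin; have [] := over_fibre (vertex_mem vv') v'j.
have [v1 [vv1 v1i h1]] := over_neighbour i vv vj.
have [v2 [vv2 v2j h2]] := over_neighbour j vv1 v1i.
(* Returning to [v] shows that [v] and [v1] have the same tight facets outside the family [x]. *)
have v2E : v2 = v by apply: (over_basis vv vj v2j) => g xg /(h1 g xg)/(h2 g xg).
rewrite {}v2E in h2.
have cone12 t : fibre_cone t v <-> fibre_cone t v1.
  split=> -[b [hb tE]]; exists b; split=> // g xg; have [b0 hbg] := hb g xg; split=> // /hbg.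
    exact: h1.
  exact: h2.
have v1min : face_min (cayley_fibre i) u (lsubmx v1).
  split; first by have [] := over_fibre (vertex_mem vv1) v1i.
  by apply/(fibre_coneP u vv1 v1i)/cone12/(fibre_coneP u vv vj).
apply: (fibre_coneP w vv vj).2 => //.
by apply/cone12/(fibre_coneP w vv1 v1i) => t ti; apply: wi.
Qed.

Lemma fibre_fan i j : normal_fan (cayley_fibre i) = normal_fan (cayley_fibre j).
Proof.
apply/seteqP; split=> C [u ->]; exists u; apply/seteqP; split=> w; exact: fibre_fan_sub.
Qed.

Lemma cayleyE : P = cayley s cayley_fibre.
Proof.
apply/seteqP; split; last first.
  by apply: (sp_convex sp) => _ [i [z [zi ->]]].
rewrite {1}(sp_conv sp) conv_vertices -(sp_conv sp); apply: conv_mono => v [_ vv].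
have [i vi] := over_vertex vv; have [vE vfib] := over_fibre (vertex_mem vv) vi.
by exists i, (lsubmx v).
Qed.

End CayleyStructure.

Section SlackSum.
Context {R : realType} {n r q : nat} (eta : 'I_r -> 'rV[int]_n) (a : 'I_r -> R) (x : 'I_q -> 'I_r).

Lemma slack_sum z : \sum_i eta (x i) = 0 -> \sum_i slack eta a (x i) z = \sum_i a (x i).
Proof.
by move=> h; rewrite big_split /= -dotv_suml -intv_sum h intv0 dotv0l add0r.
Qed.

End SlackSum.

(** In coordinates at [v0] the slacks of [x] divided by s are barycentric coordinates for the
    corners of the dilated simplex, so P lies inside it. The vertices in the last hypothesis are
    these corners. *)
Lemma simplex_case {R : realType} n r (P : set 'rV[R]_n) (eta : 'I_r -> 'rV[int]_n) a V
    (x : 'I_n.+1 -> 'I_r) (s : nat) :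
  smooth_pres P eta a V -> injective x -> \sum_i eta (x i) = 0 -> \sum_i a (x i) = s%:R ->
  (0 < s)%N ->
  (forall i, exists2 v, vertex P v & forall k, k != i -> slack eta a (x k) v = 0) ->
  lattice_iso P (scale s (@simplex R n)).
Proof.
move=> sp xi ex ax s0 xv; have [v0 vv0 hv0] := xv ord0; have [f vf] := sp_basis sp vv0.
pose g i := x (lift ord0 i).
have vg : vertex_basis eta a v0 g.
  by apply: (smooth_basis vf) => [i j /xi /lift_inj //|j]; apply: hv0.
have [P' [eta' [a' [V' [Phi [iso sp' slE coord [vP _ ex']]]]]]] := standard_position sp vv0 vg.
have sumE z : \sum_i slack eta' a' (x i) z = s%:R.
  rewrite slack_sum ?ex' // -(slack_sum a' (Phi v0) (ex' _ _ ex)).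
  by under eq_bigr do rewrite slE; rewrite slack_sum.
have sp0 : 0 < s%:R :> R by rewrite ltr0n.
suff <- : P' = scale s (@simplex R n) by [].
apply/seteqP; split=> [z Pz|_ [q [k [w [p [Sp [w0 [w1 ->]]]]]] <-]].
  exists (s%:R^-1 *: z); last by rewrite scalerA mulfV ?scale1r // gt_eqF.
  exists n.+1, (fun i => slack eta' a' (x i) z / s%:R),
    (fun i => if unlift ord0 i is Some j then delta_mx ord0 j else 0).
  split; first by move=> i; case: unliftP => [j _|_]; [right; exists j | left].
  split; first by move=> i; rewrite divr_ge0 ?(sp_ge0 sp') // ltW.
  split; first by rewrite -mulr_suml sumE mulfV ?gt_eqF.
  rewrite big_ord_recl unlift_none scaler0 add0r [in LHS](row_sum_delta z) scaler_sumr.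
  by apply: eq_bigr => j _; rewrite liftK (coord j) scalerA mulrC.
rewrite scaler_sumr; apply: (sp_convex sp' (S := P')) => //.
exists k, w, (fun i => s%:R *: p i); split; last first.
  by do 2!split=> //; apply: eq_bigr => i _; rewrite !scalerA mulrC.
have corner i : exists2 v, P' v & forall k, k != i -> slack eta' a' (x k) v = 0.
  have [v vv hv] := xv i; exists (Phi v); first by apply: vertex_mem; apply: vP.
  by move=> l li; rewrite slE hv.
move=> i; case: (Sp i) => [->|[j ->]].
  have [v Pv hv] := corner ord0; rewrite scaler0; suff <- : v = 0 by [].
  by apply/rowP => j; rewrite -(coord j) hv // mxE.
have [v Pv hv] := corner (lift ord0 j); suff <- : v = s%:R *: delta_mx ord0 j by [].
apply/rowP => l; rewrite -(coord l) !mxE eqxx /=; have [->|lj] := eqVneq l j.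
  by rewrite mulr1 -(sumE v) (bigD1 (lift ord0 j)) //= big1 ?addr0.
by rewrite mulr0 hv // (inj_eq lift_inj).
Qed.

(** Coordinates are taken at a vertex over index 0, which lies on all [x (lift ord0 i)]; its m
    further facets are listed first, so that the last p coordinates give the projection to the
    simplex. *)
Lemma cayley_position {R : realType} m p r (P : set 'rV[R]_(m + p))
    (eta : 'I_r -> 'rV[int]_(m + p)) a V (x : 'I_p.+1 -> 'I_r) (s : nat) :
  smooth_pres P eta a V -> injective x -> \sum_i eta (x i) = 0 -> \sum_i a (x i) = s%:R ->
  (forall v, vertex P v -> exists i, slack eta a (x i) v = s%:R) ->
  exists P' eta' a' V' (g : 'I_(m + p) -> 'I_r),
  [/\ lattice_iso P P', smooth_pres P' eta' a' V',
      (forall j z, slack eta' a' (g j) z = z ord0 j),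
      (forall i, g (rshift m i) = x (lift ord0 i)) &
      [/\ forall z, \sum_i slack eta' a' (x i) z = s%:R,
          forall v, vertex P' v -> exists i, slack eta' a' (x i) v = s%:R & vertex P' 0]].
Proof.
move=> sp xi ex ax xv.
have sumE z : \sum_i slack eta a (x i) z = s%:R by rewrite slack_sum.
have [v0 vv0 v00] := ex_over_vertex sp sumE xv ord0; have [f vf] := sp_basis sp vv0.
have [fi hf _] := vf.
pose X := [set x (lift ord0 i) | i in 'I_p]%SET.
pose A := ([set f j | j in 'I_(m + p)] :\: X)%SET.
have cA : #|A| = m.
  rewrite cardsDS; last first.
    apply/fintype.subsetP => _ /imsetP[i _ ->].
    have [j <-] : exists j, f j = x (lift ord0 i) by apply/hf; rewrite v00.
    exact: imset_f.
  rewrite !card_imset // ?card_ord ?addnK //.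
  by move=> i j /xi /lift_inj.
pose g j := match split j with
  | inl l => enum_val (cast_ord (esym cA) l) | inr i => x (lift ord0 i) end.
have gl l : g (lshift p l) = enum_val (cast_ord (esym cA) l).
  by rewrite /g (unsplitK (inl l : 'I_m + 'I_p)).
have gr i : g (rshift m i) = x (lift ord0 i).
  by rewrite /g (unsplitK (inr i : 'I_m + 'I_p)).
have glA l : g (lshift p l) \in A by rewrite gl enum_valP.
have gX i : g (rshift m i) \in X by rewrite gr imset_f.
have AX k : k \in A -> k \in X -> False by rewrite inE => /andP[/negP].
have gi : injective g.
  move=> j k; rewrite -[j]splitK -[k]splitK.
  case: (split j) => j'; case: (split k) => k' /=.
  - by rewrite !gl => /enum_val_inj /cast_ord_inj ->.
  - by move=> e; case: (AX _ (glA j')); rewrite e.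
  - by move=> e; case: (AX _ (glA k')); rewrite -e.
  - by rewrite !gr => /xi /lift_inj ->.
have vg : vertex_basis eta a v0 g.
  apply: (smooth_basis vf gi) => j; rewrite -[j]splitK; case: (split j) => j' /=.
    have := glA j'; rewrite inE => /andP[_ /imsetP[l _ ->]].
    by apply/hf; exists l.
  by rewrite gr v00.
have [P' [eta' [a' [V' [Phi [iso sp' slE coord [vP vP' ex']]]]]]] := standard_position sp vv0 vg.
exists P', eta', a', V', g; split=> //; split.
- move=> z; rewrite slack_sum ?ex' // -(slack_sum a' (Phi v0) (ex' _ _ ex)).
  by under eq_bigr do rewrite slE; rewrite slack_sum.
- by move=> v /vP'[u /xv[i ui] ->]; exists i; rewrite slE.
suff <- : Phi v0 = 0 by apply: vP.
apply/rowP => j; rewrite -(coord j) slE mxE.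
by have [_ hg _] := vg; apply/hg; exists j.
Qed.

Lemma simplex1E {R : realType} : @simplex R 1 = [set q | 0 <= q ord0 ord0 <= 1].
Proof.
apply/seteqP; split=> [q hq|q /= /andP[q0 q1]].
  apply/andP; split; rewrite -dotv_delta.
    apply: conv_ge hq => y [->|[i ->]]; first by rewrite dotv0r.
    by rewrite dotv_delta mxE (ord1 i) eqxx ler01.
  apply: conv_le hq => y [->|[i ->]]; first by rewrite dotv0r ler01.
  by rewrite dotv_delta mxE (ord1 i) eqxx.
have -> : q = q ord0 ord0 *: delta_mx ord0 ord0 + (1 - q ord0 ord0) *: 0.
  by apply/rowP => j; rewrite !mxE (ord1 j) eqxx mulr0 addr0 mulr1.
apply: conv_convex; rewrite ?q0 //; apply: conv_sub; first by right; exists ord0.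
by left.
Qed.

(** * One-dimensional fibres over a simplex of dilation 2 *)

Section Segments.
Context {R : realType} {p r : nat} (P : set 'rV[R]_(1 + p)).
Context (eta : 'I_r -> 'rV[int]_(1 + p)) (a : 'I_r -> R) (V : seq 'rV[R]_(1 + p)).
Context (x : 'I_p.+1 -> 'I_r) (u0 : 'I_r).
Hypothesis sp : smooth_pres P eta a V.
Hypothesis xi : injective x.
Local Notation sl := (slack eta a).
Local Notation e0 := (lshift p (ord0 : 'I_1)).
Local Notation fib := (cayley_fibre P 2).
Local Notation overx := (lies_over eta a x 2).
Hypothesis u0_coord : forall z, sl u0 z = z ord0 e0.
Hypothesis x_coord : forall i z, sl (x (lift ord0 i)) z = z ord0 (rshift 1 i).
Hypothesis x_sum : forall z, \sum_i sl (x i) z = 2.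
Hypothesis x_vertex : forall v, vertex P v -> exists i, sl (x i) v = 2.
Hypothesis vertex0 : vertex P 0.

Let lsubE (z : 'rV[R]_(1 + p)) : z ord0 e0 = lsubmx z ord0 ord0.
Proof. by rewrite mxE. Qed.

Let overP' i z : overx i z <-> rsubmx z = cayley_e R 2 i.
Proof. exact: overP. Qed.

Lemma over_origin t : overx ord0 (row_mx t 0).
Proof. by apply/overP'; rewrite row_mxKr; apply/rowP => j; rewrite !mxE. Qed.

Lemma u0_notin l : x l != u0.
Proof.
apply/eqP => xu; have := over_origin 0 l; rewrite -(over_origin (const_mx 1) l) xu.
by rewrite !u0_coord !row_mxEl !mxE => /eqP; rewrite eq_sym oner_eq0.
Qed.

(** The neighbour over i of the vertex 0 stays on the facet [u0], so its first coordinate is 0. *)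
Lemma segment_bottom i : fib i 0.
Proof.
have o0 : overx ord0 0 by rewrite -row_mx0; apply: over_origin.
have [w [vw wi hw]] := over_neighbour sp x_sum x_vertex i vertex0 o0.
have [_ ] := over_fibre x_coord x_sum (vertex_mem vw) wi.
suff -> : lsubmx w = 0 by [].
apply/rowP => j; rewrite (ord1 j) -lsubE -u0_coord hw ?mxE //.
  exact: u0_notin.
by rewrite u0_coord mxE.
Qed.

Lemma segment_top i : exists t, [/\ vertex P t, overx i t &
  forall z, fib i z -> z ord0 ord0 <= t ord0 e0].
Proof.
have [W [Wl WE]] := fibre_lattice sp x_coord x_sum i.
have [z [zi _] zmax] := vertex_min (- delta_mx ord0 ord0) WE (ex_intro _ 0 (segment_bottom i)).
have [t [vt tz ht]] := sp_vertex_below sp (- delta_mx ord0 e0) zi.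
have zo : overx i (row_mx z (cayley_e R 2 i)) by apply/overP'; rewrite row_mxKr.
have tl l : l != i -> sl (x l) t = 0.
  by move=> li; apply: ht; rewrite zo (negPf li).
exists t; split=> //.
  apply: (over_max sp x_sum (vertex_mem vt)).
  by have := x_sum t; rewrite (bigD1 i) //= big1 ?addr0.
move=> y /zmax; move: tz; rewrite !dotvNl !lerN2 !dotv_delta row_mxEl => tz zy.
exact: le_trans zy tz.
Qed.

Lemma slack_fibre k i z z' : overx i z -> overx i z' ->
  sl k z - sl k z' = (eta k ord0 e0)%:~R * (z ord0 e0 - z' ord0 e0).
Proof.
move=> /overP' zi /overP' zi'; rewrite /slack opprD addrACA subrr addr0 -dotvBr.
rewrite /dotv big_split_ord /= big_ord_recl big_ord0 addr0 big1 ?addr0.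
  by rewrite !mxE.
move=> j _; have /rowP/(_ j) := zi; rewrite -zi' !mxE => ->.
by rewrite subrr mulr0.
Qed.

(** The family's normals have first coordinate 0, so some facet at t lies outside the family; with
    the p facets [x l], l != i, it makes up the basis at t. Unimodularity makes its first coordinate
    1 or -1, and nonnegativity of its slack at the bottom of the fibre fixes the sign. *)
Lemma top_facet i t : vertex P t -> overx i t -> 0 < t ord0 e0 ->
  exists2 k, (forall l, x l != k) /\ sl k t = 0 & eta k ord0 e0 = -1.
Proof.
move=> vt ti t0; have [f vf] := sp_basis sp vt; have [_ hf fB] := vf.
have x0 l : eta (x l) ord0 e0 = 0.
  apply: (@intr_inj R); have := over_origin (const_mx 1) l; rewrite -(over_origin 0 l).
  move=> /eqP; rewrite -subr_eq0 (slack_fibre _ (over_origin _) (over_origin _)).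
  by rewrite !row_mxEl !mxE subr0 mulr1 => /eqP.
have coord0 (h : 'I_(1 + p) -> 'I_r) : (\matrix_j eta (h j)) \in unitmx ->
    exists b, 1 = \sum_j b j * eta (h j) ord0 e0.
  move=> hB; have [b bE] := basis_coord_int hB (delta_mx ord0 e0); exists b.
  transitivity ((delta_mx ord0 e0 : 'rV[int]_(1 + p)) ord0 e0); first by rewrite mxE !eqxx.
  rewrite bE summxE; by apply: eq_bigr => j _; rewrite mxE.
have [j fj] : exists j, forall l, x l != f j.
  apply: contrapT => /forallNP h; have [b] := coord0 f fB.
  rewrite big1 // => j _; have /existsNP[l /negP] := h j.
  by rewrite negbK => /eqP <-; rewrite x0 mulr0.
have ft : sl (f j) t = 0 by apply/hf; exists j.
exists (f j) => //.
pose g (k : 'I_(1 + p)) := match split k with inl _ => f j | inr l => x (lift i l) end.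
have g0 : g e0 = f j by rewrite /g (unsplitK (inl ord0 : 'I_1 + 'I_p)).
have gr l : g (rshift 1 l) = x (lift i l) by rewrite /g (unsplitK (inr l : 'I_1 + 'I_p)).
have [_ _ gB] : vertex_basis eta a t g.
  apply: (smooth_basis vf) => [k l|k].
    rewrite -[k]splitK -[l]splitK; case: (split k) => k'; case: (split l) => l' /=.
    - by rewrite (ord1 k') (ord1 l').
    - by rewrite (ord1 k') g0 gr => e; have := fj (lift i l'); rewrite e eqxx.
    - by rewrite (ord1 l') g0 gr => e; have := fj (lift i k'); rewrite e eqxx.
    - by rewrite !gr => /xi /lift_inj ->.
  rewrite -[k]splitK; case: (split k) => k' /=; first by rewrite (ord1 k') g0.
  by rewrite gr ti eq_sym (negPf (neq_lift _ _)).
have [b] := coord0 g gB; rewrite big_split_ord /= big_ord_recl big_ord0 addr0 big1 ?addr0.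
  rewrite g0; move=> bc.
  have c0 : eta (f j) ord0 e0 <= 0.
    have bi : overx i (row_mx 0 (cayley_e R 2 i)) by apply/overP'; rewrite row_mxKr.
    have : 0 <= sl (f j) (row_mx 0 (cayley_e R 2 i)) - sl (f j) t.
      by rewrite ft subr0; apply: (sp_ge0 sp) (segment_bottom i).
    rewrite (slack_fibre _ bi ti).
    by rewrite row_mxEl mxE sub0r mulrN oppr_ge0 pmulr_lle0 // lerz0.
  have : `|eta (f j) ord0 e0|%N = 1%N.
    apply/eqP; rewrite -dvdn1; have : (eta (f j) ord0 e0 %| 1)%Z.
      by apply/dvdzP; exists (b e0).
    by rewrite /dvdz.
  by lia.
by move=> l _; rewrite gr x0 mulr0.
Qed.

(** The facet bounding one segment from above bounds them all, since neighbouring vertices keep it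
    tight. Its normal is integral with first coordinate -1, and points over i have even last
    coordinates, so all lengths have the same parity. *)
Lemma segment_cayley : exists b : 'I_p.+1 -> nat,
  [/\ forall i, (0 < b i)%N, forall i j, b i = b j %[mod 2] &
      P = cayley 2 (fun i => scale (b i) (@simplex R 1))].
Proof.
have [t ht] := boolp.choice segment_top.
have tn i : exists k : nat, t i ord0 e0 = k%:R.
  have [vt _ _] := ht i; have /intrP[z zE] := sp_vertex_lat sp vt e0.
  have := sp_ge0 sp u0 (vertex_mem vt); rewrite u0_coord zE ler0z => z0.
  by exists `|z|%N; rewrite -{1}(gez0_abs z0).
have [b bE] := boolp.choice tn.
have b0 i : (0 < b i)%N.
  rewrite lt0n; apply/eqP => bi; have [_ _ tmax] := ht i.
  have : delta_mx ord0 ord0 = 0 :> 'rV[R]_1.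
    apply: (full_dim_const (c := 0) (fibre_full sp x_coord x_sum x_vertex i)).
    move=> z zi; rewrite dotv_delta; apply/eqP; rewrite eq_le.
    have := tmax z zi; rewrite bE bi => -> /=.
    by have := sp_ge0 sp u0 zi; rewrite u0_coord row_mxEl.
  by move=> /rowP/(_ ord0); rewrite !mxE !eqxx => /eqP; rewrite oner_eq0.
exists b; split=> // [i j|].
  have [vt ti _] := ht i; have [_ tj tjmax] := ht j.
  have [|k [kx kt] kc] := top_facet vt ti; first by rewrite bE ltr0n.
  have [t' [vt' t'j h]] := over_neighbour sp x_sum x_vertex j vt ti.
  have kt' := h k kx kt.
  have t'b : t' ord0 e0 = (b j)%:R.
    apply/eqP; rewrite eq_le -bE; apply/andP; split.
      have [_] := over_fibre x_coord x_sum (vertex_mem vt') t'j.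
      by move=> /tjmax; rewrite -lsubE.
    have [vtj _ _] := ht j.
    have : 0 <= sl k (t j) - sl k t' by rewrite kt' subr0; apply: (sp_ge0 sp) (vertex_mem vtj).
    rewrite (slack_fibre _ tj t'j).
    by rewrite kc mulrN1z mulN1r oppr_ge0 subr_le0.
  (* Half the contribution of the last p coordinates; the factor 2 is the dilation. *)
  pose N := \sum_l eta k ord0 (rshift 1 l) * ((l.+1 == i)%:Z - (l.+1 == j)%:Z).
  have : - ((b i)%:Z - (b j)%:Z) + 2 * N = 0.
    apply: (@intr_inj R); rewrite rmorph0.
    transitivity (sl k (t i) - sl k t'); last by rewrite kt kt' subrr.
    have -> : sl k (t i) - sl k t' = dotv (intv R (eta k)) (t i - t').
      by rewrite /slack opprD addrACA subrr addr0 -dotvBr.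
    rewrite /dotv big_split_ord /= big_ord_recl big_ord0 addr0 rmorphD rmorphN rmorphB rmorphM rmorph_sum /= mulr_sumr; congr (_ + _).
      by rewrite !mxE kc bE t'b /=; ring.
    move/overP': ti => /rowP ti; move/overP': t'j => /rowP t'j.
    apply: eq_bigr => l _; have := ti l; have := t'j l; rewrite !mxE => -> ->.
    by rewrite rmorphM rmorphB /=; case: eqP; case: eqP => _ _ /=; ring.
  lia.
rewrite {1}(cayleyE sp x_coord x_sum x_vertex); congr cayley.
apply/funext => i; have [vt ti tmax] := ht i.
have bp : 0 < (b i)%:R :> R by rewrite ltr0n.
apply/seteqP; split=> [z zi|_ [q + <-]].
  exists ((b i)%:R^-1 *: z); last by rewrite scalerA mulfV ?scale1r // gt_eqF.
  rewrite simplex1E /= mxE; apply/andP; split.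
    rewrite mulr_ge0 ?invr_ge0 ?ler0n //.
    by have := sp_ge0 sp u0 zi; rewrite u0_coord row_mxEl.
  by rewrite ler_pdivrMl // mulr1 -bE; apply: tmax.
rewrite simplex1E /= => /andP[q0 q1].
rewrite /cayley_fibre /=.
have -> : row_mx ((b i)%:R *: q) (cayley_e R 2 i) =
    q ord0 ord0 *: t i + (1 - q ord0 ord0) *: row_mx 0 (cayley_e R 2 i).
  move/overP': ti => ti; rewrite -[t i]hsubmxK ti !scale_row_mx add_row_mx; congr row_mx.
    by apply/rowP => j; rewrite !mxE !(ord1 j) mulr0 addr0 -/e0 bE mulrC.
  by rewrite -scalerDl addrC subrK scale1r.
apply: (sp_convex sp (S := P)) => //; apply: conv_convex; rewrite ?q0 //; apply: conv_sub.
  exact: vertex_mem.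
exact: segment_bottom.
Qed.

End Segments.

(** * The classification *)

Section LowerBound.
Context {R : realType}.

(** An integral affine map from P to the s-th dilate of the unimodular k-simplex, given by its
    barycentric coordinates: the structure shared by all families when n > 1. *)
Definition barycentric_forms n (P : set 'rV[R]_n) (k s : nat) : Prop :=
  exists (w : 'I_k.+1 -> 'rV[int]_n) (b : 'I_k.+1 -> int),
  [/\ forall i, w i != 0, \sum_i w i = 0, \sum_i b i = s%:Z &
      forall x i, P x -> 0 <= dotv (intv R (w i)) x + (b i)%:~R].

(** A step of size e / 2 against the sign of a nonzero coordinate of w stays in cP and lowers the
    form, so its value at z is positive; it is also an integer. *)
Lemma lattice_interior_gt0 n (P : set 'rV[R]_n) (w : 'rV[int]_n) (b : int) c z e :
  w != 0 -> (forall x, P x -> 0 <= dotv (intv R w) x + b%:~R) -> lattice_pt z -> 0 < e ->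
  (forall y : 'rV[R]_n, (forall j, `|y ord0 j - z ord0 j| < e) -> scale c P y) ->
  1 <= dotv (intv R w) z + c%:R * b%:~R.
Proof.
move=> w0 wP zl e0 ze.
have [j wj] : exists j, w ord0 j != 0.
  apply: contrapT => /forallNP h; move/eqP: w0; apply.
  by apply/rowP => j; rewrite mxE; apply/eqP; apply: contrapT => /negP; exact: h.
have wjR : intv R w ord0 j != 0 by rewrite mxE intr_eq0.
pose t := e / 2 * Num.sg (intv R w ord0 j).
have [x Px xE] : scale c P (z - t *: delta_mx ord0 j).
  have tE : `|t| = e / 2 by rewrite normrM normr_sg wjR mulr1 gtr0_norm // divr_gt0.
  apply: ze => l; have -> : (z - t *: delta_mx ord0 j) ord0 l - z ord0 l = - (t * (l == j)%:R).
    by rewrite !mxE eqxx /=; ring.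
  rewrite normrN normrM tE; case: eqP => _; rewrite ?normr1 ?normr0; lra.
have pos : 0 < dotv (intv R w) z + c%:R * b%:~R.
  have := wP x Px => h; have : 0 <= c%:R * (dotv (intv R w) x + b%:~R) by rewrite mulr_ge0.
  rewrite mulrDr -dotvZr xE dotvBr dotvZr dotv_deltar.
  have -> : t * intv R w ord0 j = e / 2 * `|intv R w ord0 j| by rewrite /t normrEsg mulrA.
  have : 0 < e / 2 * `|intv R w ord0 j| by rewrite mulr_gt0 ?normr_gt0 // divr_gt0.
  lra.
have /intrP[m mE] : dotv (intv R w) z + c%:R * b%:~R \is a Num.int.
  rewrite rpredD ?rpredM ?intr_int ?rpred_nat // rpred_sum // => l _.
  by rewrite rpredM // mxE intr_int.
by move: pos; rewrite mE ltr0z ler1z; lia.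
Qed.

Lemma codeg_lower_bound n (P : set 'rV[R]_n) k s c :
  barycentric_forms P k s -> codeg_pred P c -> (k < c * s)%N.
Proof.
move=> [w [b [w0 ws bs wP]]] /asboolP[c0 [z [zl [e [e0 ze]]]]].
have : \sum_(i < k.+1) 1 <= \sum_i (dotv (intv R (w i)) z + c%:R * (b i)%:~R).
  by apply: ler_sum => i _; apply: (lattice_interior_gt0 (w0 i) _ zl e0 ze) => x; apply: wP.
rewrite big_split /= -dotv_suml -intv_sum ws intv0 dotv0l add0r -mulr_sumr -rmorph_sum bs /=.
by rewrite sumr_const card_ord -natrM ler_nat.
Qed.

Lemma barycentric_forms_iso n (P Q : set 'rV[R]_n) k s :
  lattice_iso P Q -> barycentric_forms Q k s -> barycentric_forms P k s.
Proof.
move=> [A [b [uA QE]]] [w [be [w0 ws bs wQ]]].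
exists (fun i => w i *m A^T), (fun i => be i + (w i *m b^T) ord0 ord0); split.
- move=> i; apply: contra_neq (w0 i) => h.
  by rewrite -[w i](mulmxK (_ : A^T \in unitmx)) ?unitmx_tr // h mul0mx.
- by rewrite -mulmx_suml ws mul0mx.
- by rewrite big_split /= bs -summxE -mulmx_suml ws mul0mx mxE addr0.
move=> x i Px; have : Q (affmap A b x) by rewrite QE; exists x.
move=> /(wQ _ i); rewrite /affmap dotvDr => h.
have E1 : dotv (intv R (w i)) (x *m map_mx (fun z : int => z%:~R) A) = dotv (intv R (w i *m A^T)) x.
  rewrite !dotvE /intv (map_mxM (intr : int -> R)) trmx_mul mulmxA.
  by rewrite (map_trmx (intr : int -> R)).
have E2 : dotv (intv R (w i)) (intv R b) = ((w i *m b^T) ord0 ord0)%:~R.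
  by rewrite dotvE /intv (map_trmx (intr : int -> R)) -(map_mxM (intr : int -> R)) mxE.
by rewrite -E1 rmorphD /= -E2 [X in _ + X]addrC addrA.
Qed.

Definition corner n (s : nat) : set 'rV[R]_n :=
  [set y | (forall j, 0 <= y ord0 j) /\ \sum_j y ord0 j <= s%:R].

(** The forms are the last p coordinates and s minus their sum; for p > 0 the latter is not
    constant. *)
Lemma barycentric_forms_corner m p s (P : set 'rV[R]_(m + p)) : (0 < p)%N ->
  (forall x, P x -> corner s (rsubmx x)) -> barycentric_forms P p s.
Proof.
move=> p0 PC.
exists (fun i => row_mx 0 (if unlift ord0 i is Some j then delta_mx ord0 j else const_mx (-1))),
  (fun i => if unlift ord0 i is Some j then 0 else s%:Z); split.
- move=> i; apply/eqP => h; pose j0 := Ordinal p0.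
  case: (unliftP ord0 i) h => [j _|_] /rowP.
    by move/(_ (rshift m j)); rewrite row_mxEr !mxE !eqxx.
  by move/(_ (rshift m j0)); rewrite row_mxEr !mxE.
- rewrite big_ord_recl unlift_none; under eq_bigr do rewrite liftK.
  have -> : \sum_(i < p) row_mx 0 (delta_mx ord0 i) = row_mx 0 (const_mx 1) :> 'rV[int]_(m + p).
    have -> : const_mx 1 = \sum_i delta_mx ord0 i :> 'rV[int]_p.
      by rewrite [LHS]row_sum_delta; apply: eq_bigr => i _; rewrite mxE scale1r.
    rewrite (big_morph (fun u : 'rV[int]_p => row_mx (0 : 'rV[int]_m) u) (id1 := 0) (op1 := +%R)) //.
      by move=> u u'; rewrite add_row_mx addr0.
    exact: row_mx0.
  rewrite add_row_mx addr0 (_ : const_mx (-1) + const_mx 1 = 0) ?row_mx0 //.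
  by apply/rowP => l; rewrite !mxE addNr.
- rewrite big_ord_recl unlift_none big1 ?addr0 // => j _; by rewrite liftK.
move=> x i /PC[x0 xs]; rewrite -[x]hsubmxK.
have E (u : 'rV[int]_p) : dotv (intv R (row_mx 0 u)) (row_mx (lsubmx x) (rsubmx x)) =
    dotv (intv R u) (rsubmx x).
  by rewrite /intv map_row_mx map_mx0 dotv_row_mx dotv0l add0r.
rewrite E; case: unliftP => [j _|_].
  by rewrite intv_delta dotv_delta addr0.
rewrite -pmulrn; suff -> : dotv (intv R (const_mx (-1))) (rsubmx x) = - \sum_j rsubmx x ord0 j.
  by rewrite addrC subr_ge0.
by rewrite -sumrN; apply: eq_bigr => j _; rewrite !mxE mulN1r.
Qed.

Lemma scale_simplex_corner n s x : scale s (@simplex R n) x -> corner s x.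
Proof.
move=> [q hq <-]; split.
  move=> j; rewrite mxE mulr_ge0 // -dotv_delta; apply: conv_ge hq => y [->|[i ->]].
    by rewrite dotv0r.
  by rewrite dotv_delta mxE ler0n.
under eq_bigr do rewrite mxE; rewrite -mulr_sumr -[leRHS]mulr1 ler_wpM2l //.
under eq_bigr do rewrite -dotv_delta; rewrite -dotv_suml; apply: conv_le hq => y [->|[i ->]].
  by rewrite dotv0r.
rewrite dotv_suml (bigD1 i) //= big1 => [|j ji]; rewrite dotv_delta mxE ?eqxx ?addr0 //.
by rewrite (negPf ji) andbF.
Qed.

Lemma cayley_corner m k s (Ps : 'I_k.+1 -> set 'rV[R]_m) x : cayley s Ps x -> corner s (rsubmx x).
Proof.
move=> hx; split.
  move=> j; rewrite mxE -dotv_delta; apply: conv_ge hx => _ [i [z [_ ->]]].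
  by rewrite dotv_delta row_mxEr mxE; case: ifP.
under eq_bigr do rewrite mxE -dotv_delta; rewrite -dotv_suml; apply: conv_le hx => _ [i [z [_ ->]]].
rewrite dotv_suml; under eq_bigr do rewrite dotv_delta row_mxEr mxE.
have [j ->|->] := unliftP ord0 i; last by rewrite big1.
rewrite (bigD1 j) //= eqxx big1 ?addr0 // => l lj.
by case: eqP => // -[] /val_inj /eqP; rewrite (negPf lj).
Qed.

Lemma barycentric_forms_simplex n s : (0 < n)%N -> barycentric_forms (scale s (@simplex R n)) n s.
Proof.
move=> n0; apply: (@barycentric_forms_corner 0 n) => // x /scale_simplex_corner.
by have -> : rsubmx (x : 'rV[R]_(0 + n)) = x by apply/rowP => j; rewrite mxE; congr (x _ _); apply: val_inj.
Qed.

Lemma cast_set_id n (S : set 'rV[R]_n) : cast_set erefl S = S.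
Proof.
apply/seteqP; split=> [_ [x Sx <-]|x Sx]; first by rewrite castmx_id.
by exists x; rewrite ?castmx_id.
Qed.

End LowerBound.

(** Since p >= 1, each facet of the family contains the vertex attached to another index, which
    makes its offset integral. The constant slack sum, read off on the last adjoint polytope, is (p
    + 1) la; and p <= n because p of the facets share a vertex. *)
Lemma smooth_Qnormal_core {R : realType} n (P : set 'rV[R]_n) : (0 < n)%N ->
  lattice_polytope P -> full_dim P -> smooth P -> Qnormal P ->
  exists r (eta : 'I_r -> 'rV[int]_n) a V p (x : 'I_p.+1 -> 'I_r) (s : nat) (la : R),
  [/\ smooth_pres P eta a V, forall i, a (x i) \is a Num.int,
      [/\ injective x, \sum_i eta (x i) = 0, \sum_i a (x i) = s%:R, (0 < s)%N & (0 < p <= n)%N],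
      p.+1%:R * la = s%:R &
      [/\ forall i, exists2 v, vertex P v & forall k, k != i -> slack eta a (x k) v = 0,
          forall v i, vertex P v -> exists z : int, slack eta a (x i) v = la * z%:~R &
          forall c, (0 < c)%N -> 1 <= c%:R * la -> codeg_pred P c]].
Proof.
move=> n0 [V [Vl PV]] fd [r [eta [a [fp hv]]]] [r' [eta' [a' [fp' sE']]]].
have Pn : P !=set0 by have [p [hp _]] := fd; exists (p ord0).
have sp := smooth_presI Vl PV Pn fp hv; have [pr ei _ _] := fp.
(* Smoothness and Q-normality each supply their own facet presentation; these have the same
   inequalities. *)
have adjE t : adjoint eta' a' t = adjoint eta a t.
  apply/seteqP; split=> y hy i.
    by have [i' [-> ->]] := facet_pres_sub n0 fd fp fp' i; apply: hy.
  by have [i' [-> ->]] := facet_pres_sub n0 fd fp' fp i; apply: hy.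
have sE : sigmaP eta a = lambdaP P eta a.
  have adjF : adjoint eta' a' = adjoint eta a by apply/funext.
  by move: sE'; rewrite /sigmaP /lambdaP adjF.
have [la [la0 la_max la_vertex]] := adjoint_threshold sp n0 ei pr sE.
have [S [S0 nfS fS tS]] := ex_primitive_relation sp n0 la0 la_max la_vertex.
have [v0 vv0 _] := sp_vertex_min sp 0.
have cS : (0 < #|S|)%N.
  rewrite card_gt0; apply/eqP => SE; apply: nfS; exists v0; split=> // i.
  by rewrite SE inE.
have [p pE] : exists p, #|S| = p.+1 by exists #|S|.-1; rewrite prednK.
pose x (i : 'I_p.+1) := enum_val (cast_ord (esym pE) i).
have xS i : x i \in S by exact: enum_valP.
have xi : injective x by move=> i j /enum_val_inj /cast_ord_inj.
have xsurj k : k \in S -> exists i, k = x i.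
  move=> kS; exists (cast_ord pE (enum_rank_in kS k)).
  by rewrite /x cast_ordK enum_rankK_in.
have xsum (U : zmodType) (F : 'I_r -> U) : \sum_i F (x i) = \sum_(k in S) F k.
  rewrite [RHS]big_enum_val /= [RHS](reindex (cast_ord (esym pE))) //.
  by exists (cast_ord pE) => i _; rewrite ?cast_ordK ?cast_ordKV.
have ex : \sum_i eta (x i) = 0 by rewrite xsum.
have p0 : (0 < p)%N.
  rewrite lt0n; apply/eqP => p0; move: ex; rewrite (big_ord_recl p) big1.
    by rewrite addr0 => /eqP; rewrite (negPf (primitive_neq0 (pr _))).
  by move=> i; have := ltn_ord i; rewrite {2}p0.
have xface i : exists2 v, vertex P v & forall k, k != i -> slack eta a (x k) v = 0.
  have [v [vv hvi]] := fS _ (xS i); exists v => // k ki; apply: hvi.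
  by rewrite !inE xS andbT (inj_eq xi).
have ai i : a (x i) \is a Num.int.
  have [i' ii'] : exists i', i != i'.
    by exists (lift i (Ordinal p0)); exact: neq_lift.
  by have [v vv hvi] := xface i'; apply: (tight_int sp vv); apply: hvi.
have pn : (p <= n)%N.
  have [v vv hvi] := xface ord0; have [f vf] := sp_basis sp vv; have [_ hf _] := vf.
  have := @subset_leq_card _ [set x (lift ord0 i) | i in 'I_p]%SET [set f j | j in 'I_n]%SET.
  rewrite card_imset ?card_ord => [h|i j /xi/lift_inj//]; apply: leq_trans (h _) _.
    apply/fintype.subsetP => _ /imsetP[i _ ->].
    have [j <-] : exists j, f j = x (lift ord0 i) by apply/hf; apply: hvi.
    exact: imset_f.
  by apply: leq_trans (leq_imset_card _ _) _; rewrite cardT size_enum_ord.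
have sum0 : 0 < \sum_i a (x i).
  rewrite -(slack_sum a v0 ex).
  have s0 i : 0 <= slack eta a (x i) v0 by apply: (sp_ge0 sp); apply: vertex_mem.
  rewrite lt_neqAle sumr_ge0 // andbT eq_sym; apply/eqP => /eqP.
  rewrite psumr_eq0 // => /allP h; apply: nfS; exists v0; split=> // k /xsurj[i ->].
  by apply/eqP; apply: h; apply: mem_index_enum.
have [s sE2] : exists s : nat, \sum_i a (x i) = s%:R.
  have /intrP[z zE] : \sum_i a (x i) \is a Num.int by rewrite rpred_sum.
  move: sum0; rewrite zE ltr0z => z0; exists `|z|%N.
  by rewrite -{1}(gez0_abs (ltW z0)).
exists r, eta, a, V, p, x, s, la; split=> //.
- by split=> //; [rewrite -(ltr0n R) -sE2 | rewrite p0].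
- have [f vf] := sp_basis sp vv0; have [d [_ _ Ad]] := adjoint_ray la_vertex vv0 vf.
  rewrite -sE2 -(slack_sum a (v0 + la *: d) ex) (eq_bigr (fun=> la)) => [|i _].
    by rewrite sumr_const card_ord mulr_natl.
  exact: tS.
split=> //.
- by move=> v i vv; apply: (tight_slack_mult sp la_vertex (tS _ (xS i)) vv).
- by move=> c c0 cla; apply: (codeg_predI sp la_vertex).
Qed.

Lemma rV0_all {R : realType} (x y : 'rV[R]_0) : x = y.
Proof. by apply/rowP => -[]. Qed.

Section Cases.
Context {R : realType}.

Lemma cayley1_case m p r (P : set 'rV[R]_(m + p)) (eta : 'I_r -> 'rV[int]_(m + p)) a V
    (x : 'I_p.+1 -> 'I_r) :
  smooth_pres P eta a V -> injective x -> \sum_i eta (x i) = 0 -> \sum_i a (x i) = 1 ->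
  (forall v, vertex P v -> exists i, slack eta a (x i) v = 1) ->
  exists Ps : 'I_p.+1 -> set 'rV[R]_m,
    [/\ forall i, lattice_polytope (Ps i) /\ full_dim (Ps i),
        forall i, normal_fan (Ps i) = normal_fan (Ps ord0) & lattice_iso P (cayley 1 Ps)].
Proof.
move=> sp xi ex ax xv.
have [P' [eta' [a' [V' [g [iso sp' coord gE [x_sum x_vertex _]]]]]]] :=
  cayley_position (s := 1) sp xi ex ax xv.
have x_coord i z : slack eta' a' (x (lift ord0 i)) z = z ord0 (rshift m i).
  by rewrite -gE coord.
exists (cayley_fibre P' 1); split.
- move=> i; split; first exact: (fibre_lattice sp' x_coord x_sum).
  exact: (fibre_full sp' x_coord x_sum x_vertex).
- move=> i; exact: (fibre_fan sp' x_coord x_sum x_vertex).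
by rewrite -(cayleyE sp' x_coord x_sum x_vertex).
Qed.

Lemma cayley2_case p r (P : set 'rV[R]_(1 + p)) (eta : 'I_r -> 'rV[int]_(1 + p)) a V
    (x : 'I_p.+1 -> 'I_r) :
  smooth_pres P eta a V -> injective x -> \sum_i eta (x i) = 0 -> \sum_i a (x i) = 2 ->
  (forall v, vertex P v -> exists i, slack eta a (x i) v = 2) ->
  exists b : 'I_p.+1 -> nat, [/\ forall i, (0 < b i)%N, forall i j, b i = b j %[mod 2] &
    lattice_iso P (cayley 2 (fun i => scale (b i) (@simplex R 1)))].
Proof.
move=> sp xi ex ax xv.
have [P' [eta' [a' [V' [g [iso sp' coord gE [x_sum x_vertex v0]]]]]]] :=
  cayley_position (s := 2) sp xi ex ax xv.
have x_coord i z : slack eta' a' (x (lift ord0 i)) z = z ord0 (rshift 1 i).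
  by rewrite -gE coord.
have [b [b0 bm PE]] := segment_cayley sp' xi (coord (lshift p ord0)) x_coord x_sum x_vertex v0.
by exists b; split=> //; rewrite -PE.
Qed.

(** Slacks at v are natural numbers with positive sum s. For s = 1 this places v over a vertex of
    the simplex; for s = 2 only the value 1 is left to exclude. *)
Lemma unit_slack n r (P : set 'rV[R]_n) (eta : 'I_r -> 'rV[int]_n) a V p (x : 'I_p.+1 -> 'I_r)
    (s : nat) v :
  smooth_pres P eta a V -> (forall i, a (x i) \is a Num.int) -> \sum_i eta (x i) = 0 ->
  \sum_i a (x i) = s%:R -> (0 < s)%N -> vertex P v ->
  exists i (k : nat), slack eta a (x i) v = k%:R /\ (0 < k <= s)%N.
Proof.
move=> sp ai ex ax s0 vv; have pos i := sp_ge0 sp (x i) (vertex_mem vv).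
have sE : \sum_i slack eta a (x i) v = s%:R by rewrite slack_sum.
have [i si] : exists i, slack eta a (x i) v != 0.
  apply: contrapT => /forallNP h; move: sE; rewrite big1 => [/eqP|i _].
    by rewrite eq_sym pnatr_eq0 eqn0Ngt s0.
  by apply/eqP; apply: contrapT => /negP; exact: h.
have /intrP[z zE] := slack_int eta (ai i) (sp_vertex_lat sp vv).
have z0 : 0 <= z by rewrite -(ler0z R) -zE.
have kE : slack eta a (x i) v = `|z|%N%:R by rewrite zE -{1}(gez0_abs z0).
exists i, `|z|%N; split=> //; rewrite lt0n -(pnatr_eq0 R) -kE si /= -(ler_nat R) -kE -sE.
by rewrite (bigD1 i) //= lerDl sumr_ge0.
Qed.

End Cases.

Section Directions.
Context {R : realType}.

Lemma classification_point (P : set 'rV[R]_0) : P !=set0 ->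
  (1%:R / 2 <= (codeg P)%:R :> R) /\ lattice_iso P (scale 2 (@simplex R 0)).
Proof.
move=> [x0 Px0]; have Pall x : P x by rewrite (rV0_all x x0).
split.
  have /codegP/asboolP[c0 _] : codeg_pred P 1.
    apply/asboolP; split=> //; exists 0; split; first by case.
    exists 1; split=> // y _; exists y => //; exact: rV0_all.
  have : 1 <= (codeg P)%:R :> R by rewrite ler1n.
  lra.
exists 1%:M, 0; split; first exact: unitmx1.
apply/seteqP; split=> [y _|y _]; first by exists x0 => //; exact: rV0_all.
exists 0; last exact: rV0_all.
by apply: conv_sub; left.
Qed.

(** For n <= 1 positivity of c suffices. Otherwise the forms give k < c s, with (k, s) equal to (3,
    3), (n, 2), (k, 1) and (n - 1, 2) in cases (ii) to (v). *)
Lemma classification_converse n (P : set 'rV[R]_n) c : codeg_pred P c ->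
   ((exists (e : 1%N = n) (s : nat), (1 <= s)%N /\
         lattice_iso P (cast_set e (scale s (@simplex R 1)))) \/
       (exists e : 3%N = n, lattice_iso P (cast_set e (scale 3 (@simplex R 3)))) \/
       lattice_iso P (scale 2 (@simplex R n)) \/
       (exists (k m : nat) (e : (m + k)%N = n) (Ps : 'I_k.+1 -> set 'rV[R]_m),
         [/\ (n%:R - 1) / 2 <= k%:R :> R,
             forall i, lattice_polytope (Ps i) /\ full_dim (Ps i),
             forall i, normal_fan (Ps i) = normal_fan (Ps ord0) &
             lattice_iso P (cast_set e (cayley 1 Ps))]) \/
       (odd n /\
       exists (k : nat) (e : (1 + k)%N = n) (a : 'I_k.+1 -> nat),
         [/\ forall i, (0 < a i)%N,
             forall i j, a i = a j %[mod 2] &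
             lattice_iso P (cast_set e (cayley 2 (fun i => scale (a i) (@simplex R 1))))])) ->
  (n < c * 2)%N.
Proof.
move=> Pc; have c0 : (0 < c)%N by have /asboolP[] := Pc.
have [n1 _|n2] := leqP n 1; first by lia.
move=> [[e _]|[[e]|[|[|]]]]; first by lia.
- subst n; rewrite cast_set_id => iso.
  have := codeg_lower_bound (barycentric_forms_iso iso (@barycentric_forms_simplex R 3 3 isT)) Pc.
  lia.
- move=> iso; have := barycentric_forms_iso iso (@barycentric_forms_simplex R n 2 (ltnW n2)).
  by move=> /codeg_lower_bound/(_ Pc).
- move=> [k [m [e [Ps [kn _ _]]]]].
  have {}kn : (n <= k * 2 + 1)%N.
    move: kn; rewrite ler_pdivrMr // lerBlDr -natrM -(natrD _ _ 1) ler_nat; lia.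
  have k0 : (0 < k)%N by lia.
  subst n; rewrite cast_set_id => iso.
  have := codeg_lower_bound (barycentric_forms_iso iso
    (barycentric_forms_corner k0 (@cayley_corner _ _ _ _ Ps))) Pc.
  lia.
(* The forms only give n - 1 < 2c; oddness of n improves this to n < 2c. *)
move=> [on [k [e [b [_ _]]]]]; have k0 : (0 < k)%N by lia.
subst n; rewrite cast_set_id => iso.
have := codeg_lower_bound (barycentric_forms_iso iso
  (barycentric_forms_corner k0 (@cayley_corner _ _ _ _ _))) Pc.
by move: on; rewrite /=; lia.
Qed.

End Directions.

Theorem theorem1p3 (R : realType) (n : nat) (P : set 'rV[R]_n) :
  lattice_polytope P -> full_dim P -> smooth P -> Qnormal P ->
  ((n.+1)%:R / 2 <= (codeg P)%:R :> R <->
   ((* (i) *)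
       (exists (e : 1%N = n) (s : nat), (1 <= s)%N /\
         lattice_iso P (cast_set e (scale s (@simplex R 1)))) \/
       (* (ii) *)
       (exists e : 3%N = n, lattice_iso P (cast_set e (scale 3 (@simplex R 3)))) \/
       (* (iii) *)
       lattice_iso P (scale 2 (@simplex R n)) \/
       (* (iv) *)
       (exists (k m : nat) (e : (m + k)%N = n) (Ps : 'I_k.+1 -> set 'rV[R]_m),
         [/\ (n%:R - 1) / 2 <= k%:R :> R,
             forall i, lattice_polytope (Ps i) /\ full_dim (Ps i),
             forall i, normal_fan (Ps i) = normal_fan (Ps ord0) &
             lattice_iso P (cast_set e (cayley 1 Ps))]) \/
       (* (v) *)
       (odd n /\
       exists (k : nat) (e : (1 + k)%N = n) (a : 'I_k.+1 -> nat),
         [/\ forall i, (0 < a i)%N,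
             forall i j, a i = a j %[mod 2] &
             lattice_iso P (cast_set e (cayley 2 (fun i => scale (a i) (@simplex R 1))))]))).
Proof.
move=> lP fP smP qP; have [n0|n0] := posnP n.
  subst n; have Pn : P !=set0 by have [p [hp _]] := fP; exists (p ord0).
  have [h1 h2] := classification_point Pn.
  by split=> _ //; right; right; left.
have [r [eta [a [V [p [x [s [la [sp ai [xi ex ax s0 /andP[p0 pn]] las [xface xla xcodeg]]]]]]]]]] :=
  smooth_Qnormal_core n0 lP fP smP qP.
have la0 : 0 < la.
  by rewrite -(pmulr_rgt0 _ (ltr0Sn R p)) las ltr0n.
(* This excludes the default value 0 of [codeg]: any c above 1 / la has an interior lattice
   point. *)
have [c Pc] : exists c, codeg_pred P c.
  pose c := Num.bound la^-1.
  have cla : la^-1 < c%:R by apply: archi_boundP; rewrite invr_ge0 ltW.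
  exists c; apply: xcodeg; first by rewrite -(ltr0n R); apply: lt_trans cla; rewrite invr_gt0.
  by rewrite -ler_pdivrMr // mul1r ltW.
have Pcodeg := codegP Pc.
split=> [hc|h]; last first.
  have := classification_converse Pcodeg h.
  by rewrite ler_pdivrMr // -natrM ler_nat.
have {}hc : (n < codeg P * 2)%N by move: hc; rewrite ler_pdivrMr // -natrM ler_nat.
have js : (n./2 * s < p.+1)%N.
  have [->|j0] := posnP n./2; first by [].
  have jla : n./2%:R * la < 1.
    rewrite ltNge; apply/negP => /(xcodeg _ j0)/codeg_le; lia.
  rewrite -(ltr_nat R) natrM -las mulrCA -[ltRHS]mulr1 ltr_pM2l ?ltr0Sn //.
(* For n = 1 the half [n./2] is 0 and leaves s unbounded, so every dilate occurs. *)
have [n1|n1] := eqVneq n 1%N.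
  have pE : p = n by lia.
  subst p; have iso := simplex_case sp xi ex ax s0 xface.
  by left; subst n; exists erefl, s; rewrite cast_set_id.
have [s1|s1] := eqVneq s 1%N.
  right; right; right; left; exists p, (n - p)%N, (subnK pn).
  have kn : (n%:R - 1) / 2 <= p%:R :> R.
    rewrite ler_pdivrMr // lerBlDr -natrM -(natrD _ _ 1) ler_nat; lia.
  have xv v : vertex P v -> exists i, slack eta a (x i) v = 1.
    move=> vv; have [i [k [kE k1]]] := unit_slack sp ai ex ax s0 vv.
    by exists i; rewrite kE (_ : k = 1%N) //; lia.
  (* With n - p replaced by a variable m, n can be eliminated and the cast becomes trivial. *)
  rewrite s1 in ax; move: (subnK pn) => e; move: (n - p)%N e => m e; subst n.
  have [Ps [h1 h2 h3]] := cayley1_case sp xi ex ax xv.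
  by exists Ps; split=> //; rewrite cast_set_id.
have [pE|pE] := eqVneq p n.
  subst p; have iso := simplex_case sp xi ex ax s0 xface.
  have [s2|s2] := eqVneq s 2%N; first by right; right; left; rewrite -s2.
  (* For s >= 3 the bound floor(n / 2) * s < n + 1 with n >= 2 leaves only n = s = 3. *)
  right; left; have n3 : n = 3%N by nia.
  have s3 : s = 3%N by move: js; rewrite n3 /=; lia.
  by rewrite s3 in iso; subst n; exists erefl; rewrite cast_set_id.
(* Now floor(n / 2) * s < p + 1 <= n with s >= 2: n cannot be even, s >= 3 would need n < 3, and s =
   2 gives p = n - 1. *)
have s2 : s = 2%N by nia.
have pn1 : (1 + p)%N = n by lia.
have on : odd n by lia.
right; right; right; right; split=> //; exists p, pn1.
have xv v : vertex P v -> exists i, slack eta a (x i) v = 2.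
  move=> vv; have [i [k [kE k2]]] := unit_slack sp ai ex ax s0 vv.
  have [k1|k1] := eqVneq k 1%N; last by exists i; rewrite kE (_ : k = 2%N) //; lia.
  have [z zE] := xla v i vv.
  (* a slack 1 would be the multiple [z * (2 / n)] of [la], with [n] odd *)
  have : n%:Z = 2 * z.
    apply: (@intr_inj R); rewrite rmorphM /= -[n in LHS]pn1 add1n.
    have : p.+1%:R * (la * z%:~R) = s%:R * z%:~R by rewrite mulrA las.
    by rewrite -zE kE k1 s2 mulr1.
  by move: on; lia.
rewrite s2 in ax; subst n.
have [b [b1 b2 b3]] := cayley2_case sp xi ex ax xv.
by exists b; split=> //; rewrite cast_set_id.
Qed.
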